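(* Let $n,k\ge 1$ be integers and let $f_{rsu}$ ($1\le r,s\le n$, $1\le u\le k$) be given analytic functions of $(x_1,\dots,x_k)$, regular in a neighborhood of $(0,\dots,0)$. Consider the system $$\frac{\partial y_r}{\partial x_u}+\sum_{s=1}^{n} f_{rsu}\,y_s=0\qquad(1\le r\le n,\ 1\le u\le k)$$ for unknown functions $y_1,\dots,y_n$ of $(x_1,\dots,x_k)$, with initial conditions $y_s(0,\dots,0)=C_s$ ($1\le s\le n$), where $C_1,\dots,C_n$ are arbitrary constants. Suppose that the integrability conditions $$R_{tsuv}:=\frac{\partial f_{tsv}}{\partial x_u}-\frac{\partial f_{tsu}}{\partial x_v}+\sum_{p=1}^{n} f_{tpu}f_{psv}-\sum_{p=1}^{n} f_{tpv}f_{psu}\equiv 0$$ hold for all $1\le u,v\le k$ and $1\le t,s\le n$. Then there exist functions $P^{\langle w_1,\dots,w_k\rangle}_{ts}(x_1,\dots,x_k)$, for $w_1,\dots,w_k\in\mathbb{N}_0$ and $1\le t,s\le n$, such that $$P^{\langle 0,\dots,0\rangle}_{ts}=\delta_{ts},$$ $$P^{\langle w_1,\dots,w_u+1,\dots,w_k\rangle}_{ts}=\frac{\partial}{\partial x_u}P^{\langle w_1,\dots,w_k\rangle}_{ts}+\sum_{p=1}^{n} f_{tpu}\,P^{\langle w_1,\dots,w_k\rangle}_{ps}$$ for all $w_1,\dots,w_k\in\mathbb{N}_0$, $1\le u\le k$, $1\le t,s\le n$, and the solution of the system in a neighborhood of $(0,\dots,0)$ is given by $$y_r=\sum_{s=1}^{n}\sum_{w_1=0}^{\infty}\sum_{w_2=0}^{\infty}\cdots\sum_{w_k=0}^{\infty}\frac{(-x_1)^{w_1}}{w_1!}\frac{(-x_2)^{w_2}}{w_2!}\cdots\frac{(-x_k)^{w_k}}{w_k!}\,P^{\langle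 w_1,\dots,w_k\rangle}_{rs}\,C_s\qquad(1\le r\le n),$$ where $P^{\langle w_1,\dots,w_k\rangle}_{rs}$ is evaluated at $(x_1,\dots,x_k)$. This solution is the unique one with the given initial conditions in a neighborhood of $(0,\dots,0)$.
   Context: $\mathbb{N}_0=\{0,1,2,\dots\}$ and $\delta_{ts}$ is the Kronecker delta. ''Regular'' means analytic (holomorphic, when the variables are complex). In $P^{\langle w_1,\dots,w_u+1,\dots,w_k\rangle}_{ts}$ only the $u$-th upper index is increased by one. *)

(* Defs.v *)
From HB Require Import structures.
From mathcomp Require Import all_boot all_order all_algebra.
From mathcomp Require Import finmap complex.
From mathcomp Require Import boolp classical_sets functions reals topology.
From mathcomp Require Import normedtype sequences derive.
From mathcomp.analysis Require Import showcase.summability.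
Set Implicit Arguments.
Unset Strict Implicit.
Unset Printing Implicit Defensive.
Import Order.TTheory GRing.Theory Num.Theory.
Import numFieldNormedType.Exports.
Local Open Scope classical_set_scope.
Local Open Scope ring_scope.

(* Points (x_1, ..., x_k) are row vectors.  Their norm is the sup norm, so
   [ball 0 rho] is the open polydisc (box, in the real case) of radius rho. *)

Definition multi_index (k : nat) := {ffun 'I_k -> nat}.

Definition midx0 (k : nat) : multi_index k := [ffun=> 0%N].

Definition midx_incr (k : nat) (w : multi_index k) (u : 'I_k) : multi_index k :=
  [ffun i => (w i + (i == u))%N].

Definition basis_vec (K : numFieldType) (k : nat) (u : 'I_k) : 'rV[K]_k :=
  delta_mx 0 u.

(* The library's ['D_v] is a total operator, with an unspecified value where
   the derivative does not exist; [has_partial] asserts existence. *)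
Definition has_partial (K : numFieldType) (k : nat) (u : 'I_k)
    (g : 'rV[K]_k -> K) (x : 'rV[K]_k) : Prop :=
  derivable g x (basis_vec K u).

Definition partial (K : numFieldType) (k : nat) (u : 'I_k)
    (g : 'rV[K]_k -> K) (x : 'rV[K]_k) : K :=
  'D_(basis_vec K u) g x.

Definition monomial (K : numFieldType) (k : nat)
    (x : 'rV[K]_k) (w : multi_index k) : K :=
  \prod_(i < k) x 0 i ^+ w i.

(* Local expansion in a k-fold power series; convergence is along the directed
   set of finite sets of multi-indices, i.e. unconditional (equivalently, over
   the real or complex numbers, absolute). *)
Definition analytic_at (K : numFieldType) (k : nat)
    (g : 'rV[K]_k -> K) (a : 'rV[K]_k) : Prop :=
  exists c : multi_index k -> K,
    \forall x \near a,
      partial_sum (fun w => c w * monomial (x - a) w)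
        @ totally --> g x.

(* [iterated_sum_to m a l]: the iterated series
   sum_{w_1} (sum_{w_2} ... (sum_{w_m} a [:: w_1; ...; w_m])) converges, each
   inner series included, and its value is l. *)
Fixpoint iterated_sum_to (K : numFieldType) (m : nat)
    (a : seq nat -> K) (l : K) : Prop :=
  match m with
  | 0 => a [::] = l
  | m'.+1 => exists b : nat -> K,
      (forall j, iterated_sum_to m' (fun w => a (j :: w)) (b j)) /\
      series b @ \oo --> l
  end.

Definition midx_of_seq (k : nat) (w : seq nat) : multi_index k :=
  [ffun i : 'I_k => nth 0%N w i].

Definition integrability (K : numFieldType) (n k : nat)
    (f : 'I_n -> 'I_n -> 'I_k -> 'rV[K]_k -> K)
    (t s : 'I_n) (u v : 'I_k) (x : 'rV[K]_k) : K :=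
  partial u (f t s v) x - partial v (f t s u) x
  + \sum_(p < n) f t p u x * f p s v x
  - \sum_(p < n) f t p v x * f p s u x.

Definition solves_on (K : numFieldType) (n k : nat)
    (f : 'I_n -> 'I_n -> 'I_k -> 'rV[K]_k -> K)
    (W : set 'rV[K]_k) (y : 'I_n -> 'rV[K]_k -> K) : Prop :=
  forall (r : 'I_n) (u : 'I_k) (x : 'rV[K]_k), W x ->
    has_partial u (y r) x /\
    partial u (y r) x + \sum_(s < n) f r s u x * y s x = 0.

Definition solution_term (K : numFieldType) (n k : nat)
    (P : multi_index k -> 'I_n -> 'I_n -> 'rV[K]_k -> K) (C : 'I_n -> K)
    (r s : 'I_n) (x : 'rV[K]_k) (w : multi_index k) : K :=
  (\prod_(i < k) ((- x 0 i) ^+ w i / (w i)`!%:R)) * P w r s x * C s.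

(* Main.v *)
Require Import Defs.
From HB Require Import structures.
From mathcomp Require Import all_boot all_order all_algebra.
From mathcomp Require Import finmap complex.
From mathcomp Require Import boolp classical_sets functions reals topology.
From mathcomp Require Import normedtype sequences derive.
From mathcomp Require Import ring.
From mathcomp.analysis Require Import showcase.summability.
Import Order.TTheory GRing.Theory Num.Theory.
Import numFieldNormedType.Exports.
Local Open Scope classical_set_scope.
Local Open Scope ring_scope.
Set Implicit Arguments.
Unset Strict Implicit.
Unset Printing Implicit Defensive.

(** Write [D_u = d/dx_u + f_u] for the covariant derivative, acting on matrices
    of functions.  The integrability condition says exactly that the [D_u]
    commute, so [P w], the derivative [D ^ w] of the identity matrix, does not
    depend on the order of differentiation and satisfies the recursion.  Formally,
    the matrix [Y = \sum_w (- x) ^ w / w`! * P w] then solves the system: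
    the derivative of [(- x) ^ w / w`!] is minus the same monomial with [w_u]
    lowered by one, while [d/dx_u P w = P (w + e_u) - f_u * P w], so everything
    telescopes except [- f_u * Y]; and [Y 0] is the identity.

    To justify this, analyticity is used only through bounds on some ball around
    each point: all partial derivatives of order [l] are at most
    [c * A ^ l * l`!] there ([analytic_maj]).  The predicate [maj] records such bounds
    with [(l + m)`!] in place of [l`!].  It is stable under sums, products and
    partial derivatives with explicit constants, which gives
    [`|P w| <= B ^ j * j`!] for [j] the degree of [w], on one ball for all [w]
    ([tame_covs]).  The terms of the series and of its derivatives are then
    dominated by a multiple geometric series near 0 ([fundamental_solution]).
    Termwise differentiation ([msum_derive]) and the symmetry of mixed partial
    derivatives ([mixed_partialsC]) come from Taylor estimates, which rest on the
    mean value inequality along segments.  That inequality and the convergence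
    of geometrically dominated series are the only facts about the real or
    complex field that are needed ([calculus_field]).

    For uniqueness, the adjoint system, with coefficients the negated transpose
    of [f], is integrable too.  The transpose [Z] of its fundamental matrix
    satisfies [d/dx_u Z = Z * f_u], so [Z * z] has vanishing partial derivatives,
    hence is constant, for every solution [z].  Applied to the columns of [Y]
    this gives [Z * Y = 1], so [Z] is invertible and [z] is determined by
    [z 0]. *)

(** * Directional derivatives and one-variable calculus *)

Section DirectionalDerivative.
Variables (K : numFieldType) (V : normedModType K).

(** Directional differentiability without division: a first-order expansion
    with error at most [e * `|h|]. *)
Lemma is_deriveP (g : V -> K) (x v : V) (l : K) :
  is_derive x v g l <->
  (forall e : K, 0 < e -> exists d : K, 0 < d /\ forall h : K, `|h| < d ->
     `|g (x + h *: v) - g x - h * l| <= e * `|h|).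
Proof.
have key h : h != 0 ->
    `|g (x + h *: v) - g x - h * l|
    = `|l - h^-1 *: ((g \o shift x) (h *: v) - g x)| * `|h|.
  move=> h0; rewrite -normrM -[RHS]normrN; congr (`|_|).
  by rewrite /= [_ + x]addrC /GRing.scale /=; field.
split.
  move=> [dg gl] e e0.
  have : (fun h => h^-1 *: ((g \o shift x) (h *: v) - g x)) @ 0^' --> l.
    by rewrite -gl; exact: dg.
  move=> /cvgrPdist_lt /(_ e e0); rewrite near_withinE => /nbhs_ballP[d /= d0 H].
  exists d; split => // h hd.
  have [->|h0] := eqVneq h 0.
    by rewrite scale0r addr0 mul0r subrr subr0 normr0 mulr0.
  have := H h; rewrite /= /ball /= sub0r normrN => /(_ hd h0) /ltW Hh.
  by rewrite key // ler_wpM2r.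
move=> H.
have cv : (fun h => h^-1 *: ((g \o shift x) (h *: v) - g x)) @ 0^' --> l.
  apply/cvgrPdist_le => e e0.
  have [d [d0 Hd]] := H e e0.
  rewrite near_withinE; apply/nbhs_ballP; exists d => //= h.
  rewrite /ball /= sub0r normrN => hd h0.
  by have := Hd h hd; rewrite key // ler_pM2r // normr_gt0.
split; first by apply/cvg_ex; exists l.
exact: cvg_lim cv.
Qed.

End DirectionalDerivative.

(** The chain rule along an affine line. *)
Lemma is_derive_line (K : numFieldType) (V : normedModType K) (g : V -> K)
    (x v : V) (s h l : K) :
  is_derive (x + (s * h) *: v) v g l ->
  is_derive s 1 (fun t : K => g (x + (t * h) *: v)) (h * l).
Proof.
move=> /is_deriveP H; apply/is_deriveP => e e0.
have [h0|h0] := eqVneq h 0.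
  exists 1; split=> // t _.
  by rewrite h0 !mulr0 mul0r mulr0 subrr subr0 normr0 mulr_ge0 // ltW.
have nh : 0 < `|h| by rewrite normr_gt0.
have [d [d0 Hd]] := H (e / `|h|) (divr_gt0 e0 nh).
exists (d / `|h|); split; first exact: divr_gt0.
move=> t td; have := Hd (t * h).
have -> : e / `|h| * `|t * h| = e * `|t|.
  by rewrite normrM; field; rewrite gt_eqF.
rewrite normrM -ltr_pdivlMr // => /(_ td).
rewrite (_ : x + _ + _ = x + ((s + t *: 1) * h) *: v) ?mulrA //.
by rewrite -addrA -scalerDl -mulrDl /GRing.scale /= mulr1.
Qed.

(** The two facts of one-variable calculus that the argument uses; they hold
    over the real and over the complex numbers.  In the second, [g] is
    differentiable in the sense of [K] along the real segment from 0 to 1. *)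
Record calculus_field (K : numFieldType) : Prop := CalculusField {
  geometric_cvg : forall (b : nat -> K) (C q : K), 0 <= q -> q < 1 ->
    (forall j, `|b j| <= C * q ^+ j) -> exists l : K, series b @ \oo --> l;
  mean_value_le : forall (g g' : K -> K) (B : K),
    (forall s : K, 0 <= s <= 1 -> is_derive s 1 g (g' s) /\ `|g' s| <= B) ->
    `|g 1 - g 0| <= B
}.

Section RealCase.
Variable R : realType.

Lemma real_geometric_cvg (b : nat -> R) (C q : R) : 0 <= q -> q < 1 ->
  (forall j, `|b j| <= C * q ^+ j) -> cvgn (series b).
Proof.
move=> q0 q1 H; apply: normed_cvg.
have C0 : 0 <= C by have := le_trans (normr_ge0 _) (H 0%N); rewrite expr0 mulr1.
apply: (@series_le_cvg _ _ (geometric C q)); [by move=> n; exact: normr_ge0| |exact: H|].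
- by move=> n; rewrite /= mulr_ge0 ?exprn_ge0.
- by apply: is_cvg_geometric_series; rewrite ger0_norm.
Qed.

Lemma real_mean_value (g g' : R -> R) :
  (forall s : R, 0 <= s <= 1 -> is_derive s 1 g (g' s)) ->
  exists2 c, 0 <= c <= 1 & g 1 - g 0 = g' c.
Proof.
move=> H.
have [||c] := @MVT _ g g' 0 1 ltr01.
- by move=> x; rewrite in_itv /= => /andP[x0 x1]; apply: H; rewrite !ltW.
- apply: derivable_within_continuous => x; rewrite in_itv /= => /H[].
  by [].
rewrite in_itv /= => /andP[c0 c1] ->; exists c; first by rewrite !ltW.
by rewrite subr0 mulr1.
Qed.

Lemma real_calculus_field : calculus_field R.
Proof.
split.
  by move=> b C q q0 q1 H; exists (limn (series b)); exact: real_geometric_cvg H.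
move=> g g' B H; have [s /H[]//|c /H[_ cB] ->//] := @real_mean_value g g'.
Qed.

Local Notation re := (@complex.Re R).
Local Notation im := (@complex.Im R).

Lemma normc_ge_Im (z : R[i]) : ((`|im z|)%:C)%C <= `|z|.
Proof.
have := normc_ge_Re (z * - 'i%C); rewrite normrM normrN.
have -> : `|'i%C : R[i]| = 1 by rewrite normc_def /= expr0n expr1n add0r sqrtr1.
by rewrite mulr1 mulrN raddfN /= ReiNIm opprK.
Qed.

Lemma normc_le_ReIm (z : R[i]) :
  `|z| <= ((`|re z|)%:C)%C + ((`|im z|)%:C)%C.
Proof.
rewrite {1}[z]complexE; apply: le_trans (ler_normD _ _) _.
have nc (a : R) : `|(a%:C)%C| = ((`|a|)%:C)%C.
  by rewrite normc_def /= expr0n addr0 sqrtr_sqr.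
have ni : `|'i%C : R[i]| = 1 by rewrite normc_def /= expr0n expr1n add0r sqrtr1.
by rewrite normrM ni mul1r !nc.
Qed.

Lemma complex_calculus_field : calculus_field R[i].
Proof.
split.
  move=> b C q q0 q1 H.
  have C0 : 0 <= C by have := le_trans (normr_ge0 _) (H 0%N); rewrite expr0 mulr1.
  have [cC cq] : ((re C)%:C)%C = C /\ ((re q)%:C)%C = q.
    by split; apply: RRe_real; apply: ger0_real.
  have rq0 : 0 <= re q by rewrite -lecR cq.
  have rq1 : re q < 1 by rewrite -ltcR cq.
  have [Hr Hi] : (forall j, `|re (b j)| <= re C * re q ^+ j) /\
                 (forall j, `|im (b j)| <= re C * re q ^+ j).
    by split=> j; rewrite -lecR rmorphM rmorphXn /= cC cq;
       apply: le_trans (H j); [exact: normc_ge_Re|exact: normc_ge_Im].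
  have /cvg_ex[lr cr] := real_geometric_cvg rq0 rq1 Hr.
  have /cvg_ex[li ci] := real_geometric_cvg rq0 rq1 Hi.
  exists (lr +i* li)%C; apply/cvgrPdist_lt => e e0.
  have ce : ((re e)%:C)%C = e by apply: RRe_real; apply: ger0_real; exact: ltW.
  have re0 : 0 < re e / 2 by rewrite divr_gt0 // -ltcR ce.
  move/cvgrPdist_lt : cr => /(_ _ re0) cr.
  move/cvgrPdist_lt : ci => /(_ _ re0) ci.
  near=> n; apply: le_lt_trans (normc_le_ReIm _) _.
  have sre (m : nat) : re (series b m) = series (re \o b) m.
    by rewrite /series /=; elim/big_rec2: _ => //= j y1 y2 _ <-; case: (b j); case: y2.
  have sim (m : nat) : im (series b m) = series (im \o b) m.
    by rewrite /series /=; elim/big_rec2: _ => //= j y1 y2 _ <-; case: (b j); case: y2.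
  rewrite -rmorphD /= -ce ltcR [ltRHS]splitr.
  have -> : re ((lr +i* li)%C - series b n) = lr - series (re \o b) n.
    by rewrite -sre; case: (series b n).
  have -> : im ((lr +i* li)%C - series b n) = li - series (im \o b) n.
    by rewrite -sim; case: (series b n).
  by apply: ltrD; near: n.
move=> g g' B H.
pose d := g 1 - g 0.
have [d0|d0] := eqVneq d 0.
  rewrite -/d d0 normr0; have [|_] := H 0; first by rewrite lexx ler01.
  exact: le_trans.
(* Multiplying by the conjugate of the increment [d] reduces the mean value
   inequality to the real mean value theorem for the real part. *)
pose cd := (d^*)%C.
have nn : `|d| * `|d| = cd * d.
  by rewrite -expr2 normCK [LHS]mulrC.
pose G (s : R) := re (cd * g (s%:C)%C).
pose G' (s : R) := re (cd * g' (s%:C)%C).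
have reB (a b : R[i]) : re (a - b) = re a - re b by case: a; case: b.
have [s s01|c c01] := @real_mean_value G G'.
  have [] := H (s%:C)%C; first by rewrite -[1]/(1%:C)%C -[0]/(0%:C)%C !lecR.
  move=> /is_deriveP Hd _; apply/is_deriveP => e e0.
  have nd0 : 0 < `|cd| by rewrite normr_gt0 conjc_eq0.
  have [|dl [dl0 Hdl]] := Hd ((e%:C)%C / `|cd|).
    by rewrite divr_gt0 // ltcR.
  have cdl : ((re dl)%:C)%C = dl by apply: RRe_real; apply: ger0_real; exact: ltW.
  exists (re dl); split; first by rewrite -ltcR cdl.
  move=> h hd; have := Hdl (h%:C)%C.
  have nc (a : R) : `|(a%:C)%C| = ((`|a|)%:C)%C.
    by rewrite normc_def /= expr0n addr0 sqrtr_sqr.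
  rewrite nc -cdl ltcR => /(_ hd).
  rewrite mulrAC ler_pdivlMr // -normrM => Hh.
  rewrite -lecR rmorphM /=; apply: le_trans Hh.
  apply: le_trans (normc_ge_Re _); rewrite lecR /G /G'.
  suff -> : re (cd * g ((s + h *: 1)%:C)%C) - re (cd * g (s%:C)%C)
     - h * re (cd * g' (s%:C)%C) =
     re ((g ((s%:C)%C + (h%:C)%C *: 1) - g (s%:C)%C - (h%:C)%C * g' (s%:C)%C) * cd).
    by [].
  have rh (z : R[i]) : h * re z = re ((h%:C)%C * z).
    by case: z => ? ? /=; rewrite mul0r subr0.
  rewrite rh -!reB; congr re.
  rewrite [X in g X](_ : _ = (s%:C)%C + (h%:C)%C *: 1); first by ring.
  by rewrite rmorphD /= /GRing.scale /= !mulr1.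
move=> E.
have {}E : re (`|d| * `|d|) = re (cd * g' (c%:C)%C).
  by rewrite nn -[RHS]E /G -reB /d mulrBr.
have [] := H (c%:C)%C; first by rewrite -[1]/(1%:C)%C -[0]/(0%:C)%C !lecR.
move=> _ gB.
have nd0 : 0 < `|d| by rewrite normr_gt0.
rewrite -(ler_pM2l nd0).
have -> : `|d| * `|d| = ((re (`|d| * `|d|))%:C)%C.
  by rewrite RRe_real // ger0_real // mulr_ge0.
rewrite E; apply: (@le_trans _ _ `|cd * g' (c%:C)%C|).
  by apply: le_trans (normc_ge_Re _); rewrite lecR ler_norm.
rewrite normrM ler_pM //.
suff -> : `|cd| = `|d| by [].
by rewrite !normc_def /cd; case: (d) => a b /=; rewrite sqrrN.
Unshelve. all: by end_near.
Qed.

End RealCase.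

(** * Geometrically dominated multiple series *)

Section IteratedSums.
Variables (K : numFieldType) (hK : calculus_field K).
Implicit Types (a b : seq nat -> K) (C q : K).

(** The value of the iterated series of [iterated_sum_to]. *)
Fixpoint isum (m : nat) (a : seq nat -> K) : K :=
  match m with
  | 0 => a [::]
  | m'.+1 => limn (series (fun j => isum m' (fun w => a (j :: w))))
  end.

(** Domination by the [m]-fold geometric series of ratio [q]. *)
Definition geom_bounded (m : nat) (q C : K) (a : seq nat -> K) : Prop :=
  forall w, size w = m -> `|a w| <= C * q ^+ sumn w.

Lemma geom_boundedS m q C a j : geom_bounded m.+1 q C a ->
  geom_bounded m q (C * q ^+ j) (fun w => a (j :: w)).
Proof. by move=> H w sw; rewrite -mulrA -exprD; apply: H; rewrite /= sw. Qed.

Lemma limit_norm_le (u : nat -> K) (l B : K) :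
  0 <= B -> u @ \oo --> l -> (forall n, `|u n| <= B) -> `|l| <= B.
Proof.
move=> B0 ul uB; rewrite real_leNgt ?realE ?normr_ge0 ?B0 //; apply/negP => Bl.
have e0 : 0 < `|l| - B by rewrite subr_gt0.
move/cvgrPdist_lt : ul => /(_ _ e0) [N _ /(_ N (leqnn N))] /= H.
have := ler_normD (l - u N) (u N); rewrite subrK => T.
have := le_lt_trans T (ltr_leD H (uB N)).
by rewrite subrK ltxx.
Qed.

Lemma geometric_series_norm_le (b : nat -> K) (C q l : K) : 0 <= q -> q < 1 ->
  (forall j, `|b j| <= C * q ^+ j) -> series b @ \oo --> l ->
  `|l| <= C / (1 - q).
Proof.
move=> q0 q1 H cv.
have C0 : 0 <= C by have := le_trans (normr_ge0 _) (H 0%N); rewrite expr0 mulr1.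
have q1' : 0 < 1 - q by rewrite subr_gt0.
apply: limit_norm_le cv _; first by rewrite divr_ge0 // ltW.
move=> n; apply: le_trans (ler_norm_sum _ _ _) _.
apply: (@le_trans _ _ (\sum_(0 <= i < n) C * q ^+ i)); first exact: ler_sum.
rewrite -mulr_sumr ler_wpM2l // big_mkord -[_^-1]mul1r ler_pdivlMr //.
by rewrite mulrC -opprB mulNr -subrX1 opprB lerBlDr lerDl exprn_ge0.
Qed.

Lemma isum_spec m q C a : 0 <= q -> q < 1 -> geom_bounded m q C a ->
  iterated_sum_to m a (isum m a) /\ `|isum m a| <= C / (1 - q) ^+ m.
Proof.
move=> q0 q1; elim: m C a => [|m IH] C a H /=.
  by split => //; have := H [::] erefl; rewrite /= !expr0 divr1 mulr1.
have Hj j := IH _ _ (geom_boundedS j H).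
have Hb j : `|isum m (fun w => a (j :: w))| <= C / (1 - q) ^+ m * q ^+ j.
  by rewrite mulrAC; case: (Hj j).
have [l cv] := geometric_cvg hK q0 q1 Hb.
rewrite (cvg_lim _ cv) //; split.
  exists (fun j => isum m (fun w => a (j :: w))); split => // j.
  by case: (Hj j).
rewrite exprSr invfM mulrA.
exact: geometric_series_norm_le Hb cv.
Qed.

Lemma isum_cvg m q C a : 0 <= q -> q < 1 -> geom_bounded m.+1 q C a ->
  series (fun j => isum m (fun w => a (j :: w))) @ \oo --> isum m.+1 a.
Proof.
move=> q0 q1 H.
have Hb j : `|isum m (fun w => a (j :: w))| <= C / (1 - q) ^+ m * q ^+ j.
  by rewrite mulrAC; case: (isum_spec q0 q1 (geom_boundedS j H)).
have [l cv] := geometric_cvg hK q0 q1 Hb.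
by rewrite /= (cvg_lim _ cv).
Qed.

Lemma eq_isum m a b : (forall w, size w = m -> a w = b w) -> isum m a = isum m b.
Proof.
elim: m a b => [|m IH] a b H /=; first exact: H.
congr (limn (series _)); apply: funext => j.
by apply: IH => w sw; apply: H; rewrite /= sw.
Qed.

Lemma isum0 m : isum m (fun=> 0) = 0.
Proof.
elim: m => [//|m IH] /=; rewrite (_ : series _ = fun=> 0); first exact: lim_cst.
by apply: funext => n; rewrite /series /= big1.
Qed.

Lemma isumD m q C C' a b : 0 <= q -> q < 1 ->
  geom_bounded m q C a -> geom_bounded m q C' b ->
  isum m (fun w => a w + b w) = isum m a + isum m b.
Proof.
move=> q0 q1; elim: m C C' a b => [//|m IH] C C' a b Ha Hb.
have ca := isum_cvg q0 q1 Ha; have cb := isum_cvg q0 q1 Hb.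
apply: (cvg_lim _ _) => //; rewrite [X in X @ _ --> _](_ : _ =
  series (fun j => isum m (fun w => a (j :: w))) +
  series (fun j => isum m (fun w => b (j :: w)))); first exact: cvgD.
apply: funext => n; rewrite /series /= /GRing.add /= -big_split /=.
by apply: eq_bigr => j _; exact: IH (geom_boundedS j Ha) (geom_boundedS j Hb).
Qed.

Lemma isumZ m q C c a : 0 <= q -> q < 1 -> geom_bounded m q C a ->
  isum m (fun w => c * a w) = c * isum m a.
Proof.
move=> q0 q1; elim: m C a => [//|m IH] C a Ha.
have ca := isum_cvg q0 q1 Ha.
apply: (cvg_lim _ _) => //; rewrite [X in X @ _ --> _](_ : _ =
  (fun n => c * series (fun j => isum m (fun w => a (j :: w))) n)).
  exact: cvgMr.
apply: funext => n; rewrite /series /= mulr_sumr.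
by apply: eq_bigr => j _; exact: IH (geom_boundedS j Ha).
Qed.

Lemma isum_delta m (w0 : seq nat) c : size w0 = m ->
  isum m (fun w => if w == w0 then c else 0) = c.
Proof.
elim: m w0 => [|m IH] [|j0 w0] //= => [[sw0]].
apply: (cvg_lim _ _) => //.
rewrite -(@cvg_shiftn j0.+1) /=.
rewrite [X in X @ _ --> _](_ : _ = (fun=> c)); first exact: cvg_cst.
apply: funext => n; rewrite /series /= big_mkord.
have lj : (j0 < n + j0.+1)%N by rewrite addnS ltnS leq_addl.
rewrite (bigD1 (Ordinal lj)) //= big1 ?addr0.
  rewrite -[RHS](IH w0 sw0); apply: eq_isum => w _.
  by rewrite eqseq_cons eqxx.
move=> i; rewrite -val_eqE /= => ij.
transitivity (isum m (fun=> 0 : K)); last exact: isum0.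
apply: eq_isum => w _.
by rewrite eqseq_cons (negPf ij).
Qed.

(** Shifting one index by one, with zeros filled in, does not change the sum. *)
Lemma isum_shift m u q C a : (u < m)%N -> 0 <= q -> q < 1 ->
  geom_bounded m q C a ->
  isum m (fun w => if nth 0%N w u is n.+1 then a (set_nth 0%N w u n) else 0)
  = isum m a.
Proof.
elim: m u C a => [//|m IH] u C a um q0 q1 H.
have ca := isum_cvg q0 q1 H.
case: u um => [|u] um.
  apply: (cvg_lim _ _) => //; rewrite -cvg_shiftS.
  rewrite (_ : (fun n => _) =
    series (fun j => isum m (fun w => a (j :: w)))) //.
  apply: funext => n; rewrite /series /= big_nat_recl //.
  by rewrite [X in X + _](_ : _ = 0) ?add0r //; exact: isum0.
rewrite /=; congr (limn (series _)); apply: funext => j.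
exact: IH (geom_boundedS j H).
Qed.

End IteratedSums.

Section MultiIndexSums.
Variables (K : numFieldType) (hK : calculus_field K) (k : nat).
Implicit Types (a b : multi_index k -> K) (w : multi_index k) (C q : K).

(** The total degree of a multi-index. *)
Definition msize w : nat := (\sum_i w i)%N.

(** The sum of a family indexed by multi-indices, as an iterated series.  It
    is used for families that are [mbounded] for some [q < 1], for which all
    the series involved converge. *)
Definition msum a : K := isum k (fun s => a (midx_of_seq k s)).

(** Domination by a multiple of the [k]-fold geometric series of ratio [q]. *)
Definition mbounded q C a : Prop := forall w, `|a w| <= C * q ^+ msize w.

Lemma msize_of_seq s : size s = k -> msize (midx_of_seq k s) = sumn s.
Proof.
move=> ss; rewrite sumnE (big_nth 0%N) ss big_mkord.
by apply: eq_bigr => i _; rewrite ffunE.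
Qed.

Definition seq_of_midx w : seq nat := [seq w i | i <- enum 'I_k].

Lemma size_seq_of_midx w : size (seq_of_midx w) = k.
Proof. by rewrite size_map size_enum_ord. Qed.

Lemma nth_seq_of_midx w (i : 'I_k) : nth 0%N (seq_of_midx w) i = w i.
Proof. by rewrite (nth_map i) ?size_enum_ord // nth_ord_enum. Qed.

Lemma seq_of_midxK w : midx_of_seq k (seq_of_midx w) = w.
Proof. by apply/ffunP => i; rewrite ffunE nth_seq_of_midx. Qed.

Lemma midx_of_seqK s : size s = k -> seq_of_midx (midx_of_seq k s) = s.
Proof.
move=> ss; apply: (@eq_from_nth _ 0%N); first by rewrite size_seq_of_midx.
move=> i; rewrite size_seq_of_midx => ik.
by rewrite (nth_seq_of_midx _ (Ordinal ik)) ffunE.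
Qed.

Lemma mbounded_geom q C a : mbounded q C a ->
  geom_bounded k q C (fun s => a (midx_of_seq k s)).
Proof. by move=> H s ss; rewrite -msize_of_seq. Qed.

Lemma msum_spec q C a : 0 <= q -> q < 1 -> mbounded q C a ->
  iterated_sum_to k (fun s => a (midx_of_seq k s)) (msum a) /\
  `|msum a| <= C / (1 - q) ^+ k.
Proof. by move=> q0 q1 /mbounded_geom; apply: isum_spec. Qed.

Lemma msumD q C C' a b : 0 <= q -> q < 1 -> mbounded q C a -> mbounded q C' b ->
  msum (fun w => a w + b w) = msum a + msum b.
Proof.
by move=> q0 q1 /mbounded_geom Ha /mbounded_geom Hb; apply: (isumD hK q0 q1 Ha Hb).
Qed.

Lemma msumZ q C c a : 0 <= q -> q < 1 -> mbounded q C a ->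
  msum (fun w => c * a w) = c * msum a.
Proof. by move=> q0 q1 /mbounded_geom Ha; apply: (isumZ hK c q0 q1 Ha). Qed.

Lemma mboundedD q C C' a b : mbounded q C a -> mbounded q C' b ->
  mbounded q (C + C') (fun w => a w + b w).
Proof.
move=> Ha Hb w; rewrite mulrDl; apply: le_trans (ler_normD _ _) _.
exact: lerD.
Qed.

Lemma mboundedZ q C c a : mbounded q C a ->
  mbounded q (`|c| * C) (fun w => c * a w).
Proof. by move=> Ha w; rewrite normrM -mulrA ler_wpM2l. Qed.

Lemma msum0 : msum (fun=> 0) = 0.
Proof. exact: isum0. Qed.

Lemma eq_msum a b : a =1 b -> msum a = msum b.
Proof. by move=> ab; apply: eq_isum => s _. Qed.

Lemma msum_delta w0 c : msum (fun w => if w == w0 then c else 0) = c.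
Proof.
rewrite /msum -[RHS](isum_delta c (size_seq_of_midx w0)).
apply: eq_isum => s ss; congr (if _ then _ else _).
apply/eqP/eqP => [<-|->]; first by rewrite midx_of_seqK.
by rewrite seq_of_midxK.
Qed.

(** The multi-index [w] with its [u]-th entry lowered by one (an entry 0 is
    left unchanged). *)
Definition midx_decr w (u : 'I_k) : multi_index k :=
  [ffun i => (w i - (i == u))%N].

(** Shifting the [u]-th index by one, with zeros filled in, does not change
    the sum. *)
Lemma msum_shift u q C a : 0 <= q -> q < 1 -> mbounded q C a ->
  msum (fun w => if w u is _.+1 then a (midx_decr w u) else 0) = msum a.
Proof.
move=> q0 q1 /mbounded_geom Ha.
rewrite -[RHS](isum_shift hK (ltn_ord u) q0 q1 Ha).
apply: eq_isum => s ss; rewrite ffunE; case E: (nth _ _ _) => [//|n].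
congr (a _); apply/ffunP => i; rewrite !ffunE nth_set_nth /= val_eqE.
by case: eqP => [->|]; rewrite ?E ?subn1 ?subn0.
Qed.

Lemma mbounded_weaken q q' C C' a : 0 <= q -> q <= q' -> 0 <= C -> C <= C' ->
  mbounded q C a -> mbounded q' C' a.
Proof.
move=> q0 qq C0 CC H w; apply: le_trans (H w) _.
by apply: ler_pM => //; [exact: exprn_ge0|rewrite lerXn2r // ?nnegrE // (le_trans q0)].
Qed.

(** A finite subfamily is summed by an ordinary finite sum. *)
Lemma msum_fset q (A : {fset multi_index k}) a : 0 < q -> q < 1 ->
  (exists C, mbounded q C (fun w => if w \in A then a w else 0)) /\
  msum (fun w => if w \in A then a w else 0) = \sum_(w <- A) a w.
Proof.
move=> q0 q1.
suff H : forall s : seq (multi_index k), uniq s ->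
  (exists C, mbounded q C (fun w => if w \in s then a w else 0)) /\
  msum (fun w => if w \in s then a w else 0) = \sum_(w <- s) a w.
  exact: H (fset_uniq A).
elim=> [_|w0 s IH /=/andP[w0s us]].
  split; first by exists 0 => w; rewrite in_nil normr0 mul0r.
  by rewrite big_nil -[RHS]msum0; apply: eq_msum => w; rewrite in_nil.
have [[C HC] Hs] := IH us.
have E w : (if w \in w0 :: s then a w else 0) =
  (if w == w0 then a w0 else 0) + (if w \in s then a w else 0).
  rewrite inE; case: eqP => [->|_] /=; last by rewrite add0r.
  by rewrite (negPf w0s) addr0.
have Hd : mbounded q (`|a w0| / q ^+ msize w0) (fun w => if w == w0 then a w0 else 0).
  move=> w; case: eqP => [->|_]; first by rewrite divfK // expf_neq0 // gt_eqF.
  by rewrite normr0 mulr_ge0 ?divr_ge0 ?exprn_ge0 // ltW.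
split.
  exists (`|a w0| / q ^+ msize w0 + C) => w; rewrite E.
  exact: (mboundedD Hd HC).
rewrite big_cons -Hs -[in RHS](msum_delta w0 (a w0)).
by rewrite -(msumD (ltW q0) q1 Hd HC); apply: eq_msum.
Qed.

(** For a geometrically dominated family, the unconditional sum is the
    iterated one. *)
Lemma msum_totally q C a l : 0 < q -> q < 1 -> mbounded q C a ->
  partial_sum a @ totally --> l -> l = msum a.
Proof.
move=> q0 q1 Ha cv.
have C0 : 0 <= C.
  have := le_trans (normr_ge0 _) (Ha (midx0 k)).
  by rewrite pmulr_lge0 // exprn_gt0.
(* Outside a finite set that contains all multi-indices of size below [N], the
   family is dominated by [C * (q / q') ^+ N] times the geometric series of the
   larger ratio [q']. *)
pose q' := (q + 1) / 2.
have qq' : q < q' by rewrite /q' ltr_pdivlMr // mulr_natr mulr2n ltrD2l.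
have q'1 : q' < 1 by rewrite /q' ltr_pdivrMr // mul1r [ltRHS]mulr2n ltrD2r.
have q'0 : 0 < q' by apply: lt_trans qq'.
pose D := C / (1 - q') ^+ k.
have D0 : 0 <= D by rewrite divr_ge0 ?exprn_ge0 // subr_ge0 ltW.
pose t := q / q'.
have t0 : 0 < t by rewrite divr_gt0.
have t1 : t < 1 by rewrite ltr_pdivrMr // mul1r.
have tail N (A : {fset multi_index k}) :
  (forall w, (msize w < N)%N -> w \in A) ->
  `|msum a - \sum_(w <- A) a w| <= D * t ^+ N.
  move=> AN; have [[C1 HC1] <-] := msum_fset A a q'0 q'1.
  have Hr : mbounded q' (C * t ^+ N) (fun w => if w \in A then 0 else a w).
    move=> w; case: ifPn => [_|wA].
      by rewrite normr0 !mulr_ge0 ?exprn_ge0 // ltW.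
    apply: le_trans (Ha w) _; rewrite -mulrA ler_wpM2l //.
    have -> : q = t * q' by rewrite /t divfK // gt_eqF.
    rewrite exprMn ler_wpM2r ?exprn_ge0 ?(ltW q'0) //.
    apply: ler_wiXn2l; rewrite ?(ltW t0) ?(ltW t1) //.
    by rewrite leqNgt; apply: contra wA => /AN.
  have -> : msum a = msum (fun w => if w \in A then a w else 0) +
                     msum (fun w => if w \in A then 0 else a w).
    rewrite -(msumD (ltW q'0) q'1 HC1 Hr); apply: eq_msum => w.
    by case: ifP; rewrite ?addr0 ?add0r.
  rewrite addrAC subrr add0r.
  have [_] := msum_spec (ltW q'0) q'1 Hr.
  by rewrite /D mulrAC.
have box N : exists A : {fset multi_index k},
    forall w, (msize w < N)%N -> w \in A.
  pose F (g : {ffun 'I_k -> 'I_N}) : multi_index k := [ffun i => val (g i)].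
  exists [fset w in codom F]%fset => w wN.
  have wi i : (w i < N)%N.
    by apply: leq_ltn_trans wN; rewrite /msize (bigD1 i) //= leq_addr.
  rewrite in_fset; apply/codomP; exists [ffun i => Ordinal (wi i)].
  by apply/ffunP => i; rewrite !ffunE.
apply/eqP; rewrite -subr_eq0 -normr_eq0 eq_le normr_ge0 andbT.
have tc : (fun n => t ^+ n) @ \oo --> (0 : K).
  have Ht j : `|t ^+ j| <= 1 * t ^+ j.
    by rewrite mul1r ger0_norm // exprn_ge0 // ltW.
  have [l' cv'] := geometric_cvg hK (ltW t0) t1 Ht.
  by apply: cvg_series_cvg_0; apply/cvg_ex; exists l'.
rewrite real_leNgt ?realE ?normr_ge0 ?lexx //; apply/negP => e0.
pose e := `|l - msum a| / 2.
have e1 : 0 < e by rewrite divr_gt0.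
have eD : 0 < e / (D + 1) by rewrite divr_gt0 // ltr_wpDl.
have FT : Filter (@totally (multi_index k)) by apply: totally_filter.
move/cvgrPdist_lt : cv => /(_ _ e1) [A0 _ HA0].
move/cvgrPdist_lt : tc => /(_ _ eD) [N _ /(_ N (leqnn N))] /=.
rewrite sub0r normrN ger0_norm ?exprn_ge0 ?(ltW t0) // => HN.
have [A1 HA1] := box N.
have := HA0 (A0 `|` A1)%fset (fsubsetUl _ _).
rewrite /= /partial_sum -(big_seq_fsetE _ _ predT a) /= => H1.
have H2 := tail N (A0 `|` A1)%fset
  (fun w wN => fsubsetP (fsubsetUr A0 A1) w (HA1 w wN)).
have H3 : D * t ^+ N < e.
  apply: (@le_lt_trans _ _ ((D + 1) * t ^+ N)).
    by rewrite ler_wpM2r ?exprn_ge0 ?(ltW t0) // lerDl ler01.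
  by rewrite mulrC -ltr_pdivlMr // ltr_wpDl.
have : `|l - msum a| < e + e.
  rewrite -(subrK (\sum_(w <- (A0 `|` A1)%fset) a w) l) -addrA.
  apply: le_lt_trans (ler_normD _ _) _; apply: ltrD => //.
  by rewrite distrC; apply: le_lt_trans H3.
by rewrite /e -splitr ltxx.
Qed.

End MultiIndexSums.

(** * Partial derivatives on boxes *)

Section CalculusOnBalls.
Variables (K : numFieldType) (hK : calculus_field K) (k : nat).
Implicit Types (G H : 'rV[K]_k -> K) (x y a : 'rV[K]_k) (u v : 'I_k).

Local Notation e_ u := (basis_vec K u).
Local Notation pd u G x l := (is_derive x (basis_vec K u) G l).

Lemma rV_ballP a (r : K) x :
  ball a r x <-> 0 < r /\ forall j, `|a 0 j - x 0 j| < r.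
Proof.
split=> [[r0 H]|[r0 H]]; split=> // i; first exact: H.
by move=> j; rewrite (ord1 i); exact: H.
Qed.

Lemma segment_norm_lt (c b s r : K) :
  `|c| < r -> `|c - b| < r -> 0 <= s <= 1 -> `|c - s * b| < r.
Proof.
move=> cr cbr /andP[s0 s1].
have [->|sn] := eqVneq s 0; first by rewrite mul0r subr0.
have -> : c - s * b = (1 - s) * c + s * (c - b) by ring.
apply: le_lt_trans (ler_normD _ _) _; rewrite !normrM (ger0_norm s0).
rewrite [X in X * _ + _]ger0_norm ?subr_ge0 //.
have -> : r = (1 - s) * r + s * r by ring.
apply: ler_ltD; first by rewrite ler_wpM2l ?subr_ge0 // ltW.
by rewrite ltr_pM2l // lt_neqAle eq_sym sn.
Qed.

Lemma ball_segment a (r : K) x (z : 'rV[K]_k) (h s : K) :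
  ball a r x -> ball a r (x + h *: z) ->
  0 <= s <= 1 -> ball a r (x + (s * h) *: z).
Proof.
move=> /rV_ballP[r0 H1] /rV_ballP[_ H2] s01; apply/rV_ballP; split=> // j.
have := H2 j; have := H1 j; rewrite !mxE => h1.
rewrite !opprD !addrA => h2.
by rewrite -mulrA; apply: segment_norm_lt.
Qed.

Lemma partial_mean_value u G G' a (r B h : K) x :
  (forall y, ball a r y -> pd u G y (G' y) /\ `|G' y| <= B) ->
  ball a r x -> ball a r (x + h *: e_ u) ->
  `|G (x + h *: e_ u) - G x| <= `|h| * B.
Proof.
move=> HG bx bxh.
have := @mean_value_le _ hK (fun s => G (x + (s * h) *: e_ u))
  (fun s => h * G' (x + (s * h) *: e_ u)) (`|h| * B).
rewrite mul1r mul0r scale0r addr0; apply=> s s01.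
have [H1 H2] := HG _ (ball_segment bx bxh s01).
by split; [exact: is_derive_line|rewrite normrM ler_wpM2l].
Qed.

Lemma is_derive_mulr (c s : K) : is_derive s 1 (fun t : K => t * c) c.
Proof.
apply/is_deriveP => e e0; exists 1; split=> // h _.
rewrite [X in `|X| <= _](_ : _ = 0); last by rewrite /GRing.scale /=; ring.
by rewrite normr0 mulr_ge0 // ltW.
Qed.

Lemma partial_taylor u G G' G'' a (r B h : K) x :
  (forall y, ball a r y -> pd u G y (G' y)) ->
  (forall y, ball a r y -> pd u G' y (G'' y) /\ `|G'' y| <= B) ->
  ball a r x -> ball a r (x + h *: e_ u) ->
  `|G (x + h *: e_ u) - G x - h * G' x| <= B * `|h| ^+ 2.
Proof.
move=> HG HG' bx bxh.
have B0 : 0 <= B by have [_] := HG' _ bx; apply: le_trans.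
have := @mean_value_le _ hK
  (fun s => G (x + (s * h) *: e_ u) - s * (h * G' x))
  (fun s => h * G' (x + (s * h) *: e_ u) - h * G' x) (B * `|h| ^+ 2).
rewrite mul1r !mul0r scale0r addr0 subr0 mul1r addrAC; apply=> s s01.
have bs := ball_segment bx bxh s01.
split.
  by apply: is_deriveB; [apply/is_derive_line/HG|exact: is_derive_mulr].
rewrite -mulrBr normrM expr2 mulrA [B * _]mulrC -mulrA ler_wpM2l //.
apply: le_trans (partial_mean_value HG' bx bs) _.
rewrite mulrC ler_wpM2l // normrM ler_piMl //.
by case/andP: s01 => s0 s1; rewrite ger0_norm.
Qed.

(** The second difference of [G] along [x_u] and [x_v] approximates
    [h ^+ 2] times a mixed partial derivative. *)
Lemma second_difference u v G Gu Gvu Guvu Gvvu a (r B h : K) x :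
  (forall y, ball a r y -> pd u G y (Gu y)) ->
  (forall y, ball a r y -> pd v Gu y (Gvu y)) ->
  (forall y, ball a r y -> pd u Gvu y (Guvu y) /\ `|Guvu y| <= B) ->
  (forall y, ball a r y -> pd v Gvu y (Gvvu y) /\ `|Gvvu y| <= B) ->
  ball a r x -> ball a r (x + h *: e_ u) -> ball a r (x + h *: e_ v) ->
  ball a r (x + h *: e_ v + h *: e_ u) ->
  `|G (x + h *: e_ v + h *: e_ u) - G (x + h *: e_ u) - G (x + h *: e_ v)
    + G x - h ^+ 2 * Gvu x| <= 2 * B * `|h| ^+ 3.
Proof.
move=> Hu Hvu Huvu Hvvu bx bu bv buv.
have B0 : 0 <= B by have [_] := Huvu _ bx; apply: le_trans.
have := @mean_value_le _ hK
  (fun s => G (x + h *: e_ v + (s * h) *: e_ u) - G (x + (s * h) *: e_ u)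
            - s * (h * (h * Gvu x)))
  (fun s => h * Gu (x + h *: e_ v + (s * h) *: e_ u)
            - h * Gu (x + (s * h) *: e_ u) - h * (h * Gvu x))
  (2 * B * `|h| ^+ 3).
rewrite mul1r !mul0r scale0r !addr0 subr0 mul1r.
rewrite [X in `|X| <= _](_ : _ =
  G (x + h *: e_ v + h *: e_ u) - G (x + h *: e_ u) - G (x + h *: e_ v)
    + G x - h ^+ 2 * Gvu x); last by ring.
apply=> s s01.
have b1 := ball_segment bx bu s01.
have b2 := ball_segment bv buv s01.
split.
  apply: is_deriveB; last exact: is_derive_mulr.
  by apply: is_deriveB; apply/is_derive_line/Hu.
have b3 : ball a r (x + (s * h) *: e_ u + h *: e_ v) by rewrite addrAC.
have T1 := partial_taylor Hvu Hvvu b1 b3.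
have T2 := partial_mean_value Huvu bx b1.
have T3 : `|s * h| <= `|h|.
  by rewrite normrM ler_piMl //; case/andP: s01 => s0 s1; rewrite ger0_norm.
rewrite [X in `|X| <= _](_ : _ = h *
  ((Gu (x + (s * h) *: e_ u + h *: e_ v) - Gu (x + (s * h) *: e_ u)
     - h * Gvu (x + (s * h) *: e_ u))
   + h * (Gvu (x + (s * h) *: e_ u) - Gvu x))); last first.
  by rewrite [x + h *: _ + _]addrAC; ring.
rewrite normrM exprSr mulrA [_ * `|h|]mulrC ler_wpM2l //.
apply: le_trans (ler_normD _ _) _.
have -> : 2 * B * `|h| ^+ 2 = B * `|h| ^+ 2 + B * `|h| ^+ 2 by ring.
apply: lerD => //; rewrite normrM.
have -> : B * `|h| ^+ 2 = `|h| * (`|h| * B) by ring.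
rewrite ler_wpM2l //; apply: le_trans T2 _.
by rewrite ler_wpM2r.
Qed.

Lemma ball_near a (r : K) x : ball a r x ->
  exists2 d, 0 < d & forall y, ball x d y -> ball a r y.
Proof.
move=> bx.
have /nbhs_ballP[d d0 H] := open_nbhs_nbhs (conj (ball_open a r) bx).
by exists d.
Qed.

Lemma ball_add2 (d t t' : K) (z z' : 'rV[K]_k) x :
  (forall j, `|z 0 j| <= 1) -> (forall j, `|z' 0 j| <= 1) ->
  `|t| < d / 2 -> `|t'| < d / 2 -> ball x d (x + t *: z + t' *: z').
Proof.
move=> hz hz' td t'd.
have d0 : 0 < d by have := le_lt_trans (normr_ge0 _) td; rewrite pmulr_lgt0 ?invr_gt0.
apply/rV_ballP; split => // j; rewrite !mxE.
have -> : x 0 j - (x 0 j + t * z 0 j + t' * z' 0 j) =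
   - (t * z 0 j) - t' * z' 0 j by ring.
apply: le_lt_trans (ler_normB _ _) _; rewrite normrN [ltRHS]splitr !normrM.
apply: ltrD.
  by apply: le_lt_trans td; rewrite ler_piMr.
by apply: le_lt_trans t'd; rewrite ler_piMr.
Qed.

Lemma basis_vec_le1 u j : `|e_ u 0 j| <= 1.
Proof. by rewrite mxE; case: (_ && _); rewrite ?normr1 ?normr0 ?ler01. Qed.

(** Mixed partial derivatives commute, for functions with bounded third
    partial derivatives. *)
Lemma mixed_partialsC u v G Gu Gv Gvu Guv T1 T2 T3 T4 a (r B : K) x :
  (forall y, ball a r y -> pd u G y (Gu y)) ->
  (forall y, ball a r y -> pd v G y (Gv y)) ->
  (forall y, ball a r y -> pd v Gu y (Gvu y)) ->
  (forall y, ball a r y -> pd u Gv y (Guv y)) ->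
  (forall y, ball a r y -> pd u Gvu y (T1 y) /\ `|T1 y| <= B) ->
  (forall y, ball a r y -> pd v Gvu y (T2 y) /\ `|T2 y| <= B) ->
  (forall y, ball a r y -> pd v Guv y (T3 y) /\ `|T3 y| <= B) ->
  (forall y, ball a r y -> pd u Guv y (T4 y) /\ `|T4 y| <= B) ->
  ball a r x -> Gvu x = Guv x.
Proof.
move=> Hu Hv Hvu Huv H1 H2 H3 H4 bx.
have B0 : 0 <= B by have [_] := H1 _ bx; apply: le_trans.
have [d d0 Hd] := ball_near bx.
apply/eqP; rewrite -subr_eq0 -normr_eq0; apply/negP => /negP D0.
have {}D0 : 0 < `|Gvu x - Guv x| by rewrite lt_neqAle eq_sym D0 normr_ge0.
set D := `|Gvu x - Guv x| in D0.
(* With a step [h] this small, the two approximations of the same second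
   difference contradict that the mixed derivatives differ by [D]. *)
pose h : K := (4 / d + (4 * B + 1) / D)^-1.
have h0 : 0 < h.
  by rewrite invr_gt0 addr_gt0 // divr_gt0 // ltr_wpDl // mulr_ge0.
have hd : `|h| < d / 2.
  rewrite gtr0_norm // /h -[d / 2]invrK ltf_pV2 ?posrE ?invr_gt0 ?divr_gt0 //; last first.
    by rewrite addr_gt0 // divr_gt0 // ltr_wpDl // mulr_ge0.
  rewrite invf_div; apply: (@lt_trans _ _ (4 / d)).
    by rewrite ltr_pM2r ?invr_gt0 // ltr_nat.
  by rewrite ltrDl divr_gt0 // ltr_wpDl // mulr_ge0.
have hd0 : `|0 : K| < d / 2 by rewrite normr0 divr_gt0.
have bu w : ball a r (x + h *: e_ w).
  apply: Hd; rewrite -[_ + _]addr0 -(scale0r (e_ w)).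
  by apply: ball_add2 => //; exact: basis_vec_le1.
have buv w w' : ball a r (x + h *: e_ w + h *: e_ w').
  by apply: Hd; apply: ball_add2 => //; exact: basis_vec_le1.
have E1 := second_difference Hu Hvu H1 H2 bx (bu u) (bu v) (buv v u).
have E2 := second_difference Hv Huv H3 H4 bx (bu v) (bu u) (buv u v).
have E3 : `|h ^+ 2 * (Gvu x - Guv x)| <= 4 * B * `|h| ^+ 3.
  have -> : 4 * B * `|h| ^+ 3 = 2 * B * `|h| ^+ 3 + 2 * B * `|h| ^+ 3 by ring.
  have := lerD E2 E1; apply: le_trans.
  apply: le_trans (ler_normB _ _); rewrite [x + h *: e_ v + _]addrAC.
  by rewrite le_eqVlt; apply/orP; left; apply/eqP; congr (`|_|); ring.
move: E3; rewrite normrM normrX gtr0_norm // -/D.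
have -> : 4 * B * h ^+ 3 = h ^+ 2 * (4 * B * h) by ring.
rewrite ler_pM2l ?exprn_gt0 // /h ler_pdivlMr; last first.
  by rewrite addr_gt0 // divr_gt0 // ltr_wpDl // mulr_ge0.
have -> : D * (4 / d + (4 * B + 1) / D) = 4 * B + (4 * D / d + 1).
  by field; rewrite !gt_eqF.
rewrite gerDl; apply/negP; rewrite lt_geF //.
by rewrite addr_gt0 // divr_gt0 // mulr_gt0.
Qed.

(** A function on a box with vanishing partial derivatives is constant. *)
Lemma zero_partials_constant G (r : K) :
  (forall u y, ball 0 r y -> pd u G y 0) ->
  forall x, ball (0 : 'rV[K]_k) r x -> G x = G 0.
Proof.
move=> HG x bx.
(* The point [p j] has the first [j] coordinates of [x] and is zero elsewhere. *)
pose p (j : nat) : 'rV[K]_k := \row_i (if (i < j)%N then x 0 i else 0).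
have r0 : 0 < r by case/rV_ballP: bx.
have bp j : ball 0 r (p j).
  apply/rV_ballP; split=> // i; rewrite !mxE; case: ifP => _.
    by have [_ /(_ i)] := (rV_ballP _ _ _).1 bx; rewrite mxE.
  by rewrite subr0 normr0.
have -> : x = p k by apply/rowP => i; rewrite mxE ltn_ord.
have <- : p 0%N = 0 by apply/rowP => i; rewrite !mxE.
suff H j : (j <= k)%N -> G (p j) = G (p 0%N) by exact: H.
elim: j => [//|j IH jk]; rewrite -IH ?(ltnW jk) //.
pose u := Ordinal jk.
have E : p j.+1 = p j + x 0 u *: e_ u.
  apply/rowP => i; rewrite !mxE eqxx /= ltnS leq_eqVlt -val_eqE /=.
  case: eqP => [ij|_] /=; last by rewrite mulr0 addr0.
  by rewrite ij ltnn add0r mulr1; congr (x 0 _); apply: val_inj.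
apply/eqP; rewrite -subr_eq0 -normr_le0 -(mulr0 `|x 0 u|) E.
apply: (@partial_mean_value u G (fun=> 0) 0 r) => //; last by rewrite -E.
by move=> y hy; split; [exact: HG|rewrite normr0].
Qed.

End CalculusOnBalls.

(** * Functions with geometrically bounded derivatives *)

Lemma exists_pos_le2 (K : numFieldType) (a b : K) : 0 < a -> 0 < b ->
  exists2 c, 0 < c & c <= a /\ c <= b.
Proof.
move=> a0 b0; have := real_leVge (gtr0_real a0) (gtr0_real b0).
by case/orP => H; [exists a|exists b].
Qed.

Section Majorants.
Variables (K : numFieldType) (k : nat).
Implicit Types (G H : 'rV[K]_k -> K) (x y a : 'rV[K]_k) (u v : 'I_k).
Implicit Types (V : set 'rV[K]_k) (A c d : K) (N m : nat).

Local Notation e_ u := (basis_vec K u).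
Local Notation pd u G x l := (is_derive x (basis_vec K u) G l).

Lemma pdP u G x : has_partial u G x -> pd u G x (partial u G x).
Proof. by move=> H; split. Qed.

(** [maj V A N G c m]: on [V] the partial derivatives of [G] of each order
    [l <= N] exist and are bounded by [c * A ^+ l * (l + m)`!], as if [G] were
    majorized by a multiple of a power of a geometric series. *)
Fixpoint maj V A N G c m : Prop :=
  (forall x, V x -> `|G x| <= c * m`!%:R) /\
  match N with
  | 0 => True
  | N'.+1 => forall u, (forall x, V x -> has_partial u G x) /\
                       maj V A N' (partial u G) (c * A) m.+1
  end.

Lemma maj_bound V A N G c m : maj V A N G c m ->
  forall x, V x -> `|G x| <= c * m`!%:R.
Proof. by case: N => [|N] []. Qed.

Lemma majS V A N G c m : maj V A N.+1 G c m -> maj V A N G c m.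
Proof.
elim: N G c m => [|N IH] G c m; first by case.
move=> [HG H]; split=> // u; have [H1 H2] := H u.
by split=> //; exact: IH.
Qed.

Lemma pd_ext V u G H x l : open V -> V x -> (forall y, V y -> G y = H y) ->
  pd u G x l -> pd u H x l.
Proof.
move=> Vo Vx GH /is_deriveP HG; apply/is_deriveP => e e0.
have [d [d0 Hd]] := HG e e0.
have /nbhs_ballP[d' d'0 Hd'] := open_nbhs_nbhs (conj Vo Vx).
have d'0' : 0 < d' by [].
have [t t0 [td td']] := exists_pos_le2 d0 d'0'.
exists t; split => // h ht.
have hd := lt_le_trans ht td; have hd' := lt_le_trans ht td'.
rewrite -!GH //; first exact: Hd.
apply: Hd'; apply/rV_ballP; split=> // j; rewrite !mxE opprD addrA subrr sub0r.
rewrite normrN normrM; apply: le_lt_trans hd'; rewrite ler_piMr //.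
by have := basis_vec_le1 K u j; rewrite mxE.
Qed.

Lemma maj_ext V A N G H c m : open V -> (forall x, V x -> G x = H x) ->
  maj V A N G c m -> maj V A N H c m.
Proof.
move=> Vo; elim: N G H c m => [|N IH] G H c m GH [HG HN].
  by split=> // x Vx; rewrite -GH //; exact: HG.
split; first by move=> x Vx; rewrite -GH //; exact: HG.
move=> u; have [H1 H2] := HN u.
have E x : V x -> pd u H x (partial u G x).
  by move=> Vx; apply: (pd_ext Vo Vx GH); exact: pdP (H1 x Vx).
split; first by move=> x Vx; case: (E x Vx).
apply: IH H2 => x Vx; have [_ <-] := E x Vx.
by rewrite /partial.
Qed.

(** Majorants of [G] from an explicit family of partial derivatives. *)
Lemma maj_step V A N G (G' : 'I_k -> 'rV[K]_k -> K) c m : open V ->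
  (forall x, V x -> `|G x| <= c * m`!%:R) ->
  (forall u x, V x -> pd u G x (G' u x)) ->
  (forall u, maj V A N (G' u) (c * A) m.+1) -> maj V A N.+1 G c m.
Proof.
move=> Vo HG pG HN; split=> // u; split; first by move=> x /(pG u)[].
apply: maj_ext (HN u) => // x Vx.
by have [_ <-] := pG u x Vx.
Qed.

Lemma maj_weaken V V' A A' N G c c' m : V' `<=` V -> 0 <= A -> A <= A' ->
  0 <= c -> c <= c' -> maj V A N G c m -> maj V' A' N G c' m.
Proof.
move=> VV A0 AA; elim: N G c c' m => [|N IH] G c c' m c0 cc [HG HN].
  by split=> // x /VV /HG; move/le_trans; apply; rewrite ler_wpM2r.
split.
  by move=> x /VV /HG; move/le_trans; apply; rewrite ler_wpM2r.
move=> u; have [H1 H2] := HN u; split; first by move=> x /VV /H1.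
by apply: IH H2; [exact: mulr_ge0|exact: ler_pM].
Qed.

Lemma maj0 V A N m : open V -> maj V A N (fun=> 0) 0 m.
Proof.
move=> Vo; elim: N m => [|N IH] m.
  by split=> // x _; rewrite normr0 mul0r.
apply: (@maj_step _ _ _ _ (fun _ _ => 0)) => //.
- by move=> x _; rewrite normr0 mul0r.
- by move=> u; rewrite mul0r; exact: IH.
Qed.

Lemma maj_cst V A N (z c : K) : open V -> 0 <= A -> `|z| <= c ->
  maj V A N (fun=> z) c 0.
Proof.
move=> Vo A0 zc; have c0 : 0 <= c by exact: le_trans zc.
case: N => [|N].
  by split=> // x _; rewrite fact0 mulr1.
apply: (@maj_step _ _ _ _ (fun _ _ => 0)) => //.
- by move=> x _; rewrite fact0 mulr1.
- move=> u; apply: (maj_weaken _ A0 (lexx A) _ _ (maj0 A N 1 Vo)) => //.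
  exact: mulr_ge0.
Qed.

Lemma majD V A N G H c d m : open V -> maj V A N G c m -> maj V A N H d m ->
  maj V A N (fun x => G x + H x) (c + d) m.
Proof.
move=> Vo; elim: N G H c d m => [|N IH] G H c d m [G0 GN] [H0 HN].
  split=> // x Vx; rewrite mulrDl; apply: le_trans (ler_normD _ _) _.
  by apply: lerD; [exact: G0|exact: H0].
apply: (@maj_step _ _ _ _ (fun u x => partial u G x + partial u H x)) => //.
- move=> x Vx; rewrite mulrDl; apply: le_trans (ler_normD _ _) _.
  by apply: lerD; [exact: G0|exact: H0].
- move=> u x Vx; apply: is_deriveD; apply: pdP.
    by have [+ _] := GN u; apply.
  by have [+ _] := HN u; apply.
- move=> u; rewrite mulrDl; apply: IH; first by case: (GN u).
  by case: (HN u).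
Qed.

Lemma maj_sum V A N (I : Type) (s : seq I) (F : I -> 'rV[K]_k -> K) c m :
  open V -> (forall i, maj V A N (F i) c m) ->
  maj V A N (fun x => \sum_(i <- s) F i x) (c *+ size s) m.
Proof.
move=> Vo HF; elim: s => [|i s IH].
  rewrite mulr0n; apply: (maj_ext Vo _ (maj0 A N m Vo)) => x _.
  by rewrite big_nil.
rewrite /= mulrS; apply: (maj_ext Vo _ (majD Vo (HF i) IH)) => x _.
by rewrite big_cons.
Qed.

(** The bound [c * A ^+ l * (l + m)`!] is the [l]-th derivative at 0 of
    [c * m`! * (1 - A * s) ^- m.+1]; multiplying two such functions of [s] gives
    the constants for the product. *)
Lemma majM V A N G H c d m j : open V -> maj V A N G c m -> maj V A N H d j ->
  maj V A N (fun x => G x * H x)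
    (c * d * (m`! * j`!)%:R / (m + j).+1`!%:R) (m + j).+1.
Proof.
move=> Vo.
have base G' H' c' d' m' j' : (forall x, V x -> `|G' x| <= c' * m'`!%:R) ->
    (forall x, V x -> `|H' x| <= d' * j'`!%:R) ->
    forall x, V x -> `|G' x * H' x| <=
      c' * d' * (m'`! * j'`!)%:R / (m' + j').+1`!%:R * (m' + j').+1`!%:R.
  move=> HG HH x Vx; rewrite divfK ?pnatr_eq0 -?lt0n ?fact_gt0 //.
  rewrite normrM natrM mulrACA.
  by apply: ler_pM => //; [exact: HG|exact: HH].
elim: N G H c d m j => [|N IH] G H c d m j [G0 GN] [H0 HN].
  by split=> //; exact: base.
apply: (@maj_step _ _ _ _
  (fun u x => partial u G x * H x + G x * partial u H x)) => //.
- exact: base.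
- move=> u x Vx; have [/(_ x Vx)/pdP pG _] := GN u.
  have [/(_ x Vx)/pdP pH _] := HN u.
  have := is_deriveM pG pH; rewrite /GRing.scale /= addrC.
  by rewrite [H x * _]mulrC.
- move=> u; have [_ mG] := GN u; have [_ mH] := HN u.
  have mG' : maj V A N G c m by apply: majS; split.
  have mH' : maj V A N H d j by apply: majS; split.
  have := majD Vo (IH _ _ _ _ _ _ mG mH')
    (_ : maj V A N (fun x => G x * partial u H x) _ (m.+1 + j).+1).
  rewrite addSn => K1.
  have := IH _ _ _ _ _ _ mG' mH; rewrite addnS => /K1.
  set e1 := (X in maj _ _ _ _ X _); set e2 := (X in _ -> maj _ _ _ _ X _).
  suff -> : e1 = e2 by [].
  rewrite /e1 /e2 !factS !natrM -[(m + j).+2%:R]natr1 -[(m + j).+1%:R]natr1.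
  rewrite -[m.+1%:R]natr1 -[j.+1%:R]natr1 natrD.
  have f0 : (m + j)`!%:R != 0 :> K by rewrite pnatr_eq0 -lt0n fact_gt0.
  have s1 : m%:R + j%:R + 1 != 0 :> K by rewrite -natrD natr1 pnatr_eq0.
  have s2 : m%:R + j%:R + 1 + 1 != 0 :> K by rewrite -natrD !natr1 pnatr_eq0.
  by field; rewrite s1 s2 f0.
Qed.

Lemma maj_pd V A N G c m u x : maj V A N.+1 G c m -> V x ->
  pd u G x (partial u G x).
Proof. by move=> [_ /(_ u)[H _]] Vx; exact: pdP (H x Vx). Qed.

Lemma maj_partial V A N G c m u : maj V A N.+1 G c m ->
  maj V A N (partial u G) (c * A) m.+1.
Proof. by move=> [_ /(_ u)[]]. Qed.

End Majorants.

(** * Termwise differentiation *)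

Section TermwiseDerivative.
Variables (K : numFieldType) (hK : calculus_field K) (k : nat).
Local Notation pd u G x l := (is_derive x (basis_vec K u) G l).

(** Termwise differentiation of a geometrically dominated series. *)
Lemma msum_derive (u : 'I_k) (F F' F'' : multi_index k -> 'rV[K]_k -> K)
    (g : 'rV[K]_k -> K) (a : 'rV[K]_k) (r q C : K) (x : 'rV[K]_k) :
  0 <= q -> q < 1 ->
  (forall w y, ball a r y -> pd u (F w) y (F' w y)) ->
  (forall w y, ball a r y -> pd u (F' w) y (F'' w y)) ->
  (forall y, ball a r y -> mbounded q C (fun w => F w y)) ->
  (forall y, ball a r y -> mbounded q C (fun w => F' w y)) ->
  (forall y, ball a r y -> mbounded q C (fun w => F'' w y)) ->
  (forall y, ball a r y -> g y = msum (fun w => F w y)) ->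
  ball a r x -> pd u g x (msum (fun w => F' w x)).
Proof.
move=> q0 q1 pF pF' bF bF' bF'' gF bx; apply/is_deriveP => e e0.
have [d d0 Hd] := ball_near bx.
have C0 : 0 <= C.
  have [->|qn] := eqVneq C 0; first by rewrite lexx.
  have /(_ (midx0 k)) := bF x bx; rewrite /msize big1; last by move=> i _; rewrite ffunE.
  by rewrite expr0 mulr1; apply: le_trans.
pose D := C / (1 - q) ^+ k.
have D0 : 0 <= D by rewrite divr_ge0 // exprn_ge0 // subr_ge0 ltW.
have D1 : 0 < D + 1 by rewrite ltr_wpDl.
have [dl dl0 [dld dle]] := exists_pos_le2 d0 (divr_gt0 e0 D1).
exists dl; split => // h hdl.
have bxh : ball a r (x + h *: basis_vec K u).
  apply: Hd; apply/rV_ballP; split=> // j; rewrite !mxE opprD addrA subrr sub0r.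
  rewrite normrN normrM; apply: lt_le_trans dld; apply: le_lt_trans hdl.
  by rewrite ler_piMr //; have := basis_vec_le1 K u j; rewrite mxE.
have b1 := mboundedZ (-1) (bF x bx).
have b2 := mboundedZ (- h) (bF' x bx).
have b12 := mboundedD b1 b2.
have -> : g (x + h *: basis_vec K u) - g x - h * msum (fun w => F' w x) =
  msum (fun w => F w (x + h *: basis_vec K u) + (-1 * F w x + (- h) * F' w x)).
  rewrite (msumD hK q0 q1 (bF _ bxh) b12) (msumD hK q0 q1 b1 b2).
  rewrite (msumZ hK (-1) q0 q1 (bF x bx)) (msumZ hK (- h) q0 q1 (bF' x bx)).
  by rewrite !gF // mulN1r mulNr addrA.
have bq : mbounded q (C * `|h| ^+ 2) (fun w =>
    F w (x + h *: basis_vec K u) + (-1 * F w x + (- h) * F' w x)).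
  move=> w; rewrite mulN1r mulNr addrA mulrAC.
  apply: (partial_taylor hK (pF w) _ bx bxh) => y hy.
  by split; [exact: pF'|exact: bF''].
have [_ H] := msum_spec hK q0 q1 bq; apply: le_trans H _.
rewrite mulrAC -/D expr2 mulrA ler_wpM2r //.
apply: (@le_trans _ _ ((D + 1) * `|h|)).
  by rewrite ler_wpM2r // lerDl ler01.
rewrite mulrC -ler_pdivlMr //; exact: le_trans (ltW hdl) dle.
Qed.

End TermwiseDerivative.

(** * Analytic functions *)

Lemma bin_le_expn2 n m : ('C(n, m) <= 2 ^ n)%N.
Proof.
elim: n m => [|n IH] [|m]; rewrite ?bin0 ?bin0n ?expn_gt0 //.
by rewrite binS expnS mul2n -addnn leq_add.
Qed.

Lemma fact_mul_le m n : (m`! * n`! <= (m + n)`!)%N.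
Proof.
have := bin_fact (leq_addr n m); rewrite addKn => <-.
by rewrite leq_pmull // bin_gt0 leq_addr.
Qed.

Lemma prod_fact_le k (v : multi_index k) : (\prod_i (v i)`! <= (msize v)`!)%N.
Proof.
rewrite /msize; elim/big_rec2: _ => // i n m _ H.
by apply: leq_trans (fact_mul_le _ _); rewrite leq_mul2l H orbT.
Qed.

Section Monomials.
Variables (K : numFieldType) (k : nat).
Implicit Types (x y a : 'rV[K]_k) (u : 'I_k) (v w : multi_index k).
Local Notation pd u G x l := (is_derive x (basis_vec K u) G l).

(** The partial derivative of multi-order [v] of the monomial
    [y |-> (y - a) ^ w]. *)
Definition dmono a v w y : K :=
  \prod_i ((w i ^_ v i)%:R * (y 0 i - a 0 i) ^+ (w i - v i)).

Lemma is_derive_constant_line u (G : 'rV[K]_k -> K) x :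
  (forall h, G (x + h *: basis_vec K u) = G x) -> pd u G x 0.
Proof.
move=> H; apply/is_deriveP => e e0; exists 1; split => // h _.
by rewrite H subrr mulr0 subrr normr0 mulr_ge0 // ltW.
Qed.

Lemma is_derive_coord u a x : pd u (fun y => y 0 u - a 0 u) x 1.
Proof.
apply/is_deriveP => e e0; exists 1; split => // h _.
rewrite !mxE !eqxx /= [X in `|X| <= _](_ : _ = 0); last by ring.
by rewrite normr0 mulr_ge0 // ltW.
Qed.

Lemma is_derive_dmono u a v w x :
  pd u (dmono a v w) x (dmono a (midx_incr v u) w x).
Proof.
pose c : K := (w u ^_ v u)%:R; pose n := (w u - v u)%N.
pose G y := \prod_(i | i != u) ((w i ^_ v i)%:R * (y 0 i - a 0 i) ^+ (w i - v i)).
have E : dmono a v w = (c \*: (fun y : 'rV[K]_k => y 0 u - a 0 u) ^+ n) * G.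
  apply: funext => y; rewrite /dmono (bigD1 u) //=; congr (_ * _).
  by rewrite /GRing.scale /= fctE.
rewrite E.
have pG : pd u G x 0.
  apply: is_derive_constant_line => h; apply: eq_bigr => i iu.
  by rewrite !mxE (negPf iu) /= mulr0 addr0.
have := is_deriveM (is_deriveZ c (is_deriveX n (is_derive_coord u a x))) pG.
set l1 := (X in is_derive _ _ _ X -> _); set l2 := dmono _ _ _ _.
suff -> : l1 = l2 by [].
rewrite /l1 /l2 /dmono (bigD1 u) //= /GRing.scale /= mulr0 add0r mulr1.
have -> : \prod_(i | i != u) ((w i ^_ midx_incr v u i)%:R
   * (x 0 i - a 0 i) ^+ (w i - midx_incr v u i)) = G x.
  by apply: eq_bigr => i iu; rewrite ffunE (negPf iu) addn0.
rewrite mulrC; congr (_ * _); rewrite ffunE eqxx addn1 ffactnSr subnS natrM.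
by rewrite mulrA.
Qed.

Lemma dmono_norm_le a v w x (r : K) : ball a r x ->
  `|dmono a v w x| <= (msize v)`!%:R * r^-1 ^+ msize v * (2 * r) ^+ msize w.
Proof.
move=> /rV_ballP[r0 H].
have r2 : 0 <= 2 * r by rewrite mulr_ge0 // ltW.
have ri : 0 <= r^-1 by rewrite invr_ge0 ltW.
apply: (@le_trans _ _ (\prod_i (((v i)`!)%:R * r^-1 ^+ v i * (2 * r) ^+ w i))).
  rewrite normr_prod; apply: ler_prod => i _; rewrite normr_ge0 /=.
  have [vw|vw] := leqP (v i) (w i); last first.
    by rewrite ffact_small // mul0r normr0 !mulr_ge0 ?exprn_ge0.
  rewrite normrM normrX ger0_norm // -bin_ffact natrM.
  have h1 : `|x 0 i - a 0 i| ^+ (w i - v i) <= r ^+ (w i - v i).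
    by rewrite lerXn2r ?nnegrE ?(ltW r0) // distrC ltW.
  apply: (@le_trans _ _ ((2 ^ w i)%:R * (v i)`!%:R * r ^+ (w i - v i))).
    apply: ler_pM h1; [by rewrite mulr_ge0|by rewrite exprn_ge0|].
    by rewrite ler_wpM2r // ler_nat bin_le_expn2.
  rewrite natrX exprMn expfB_cond ?(gt_eqF r0) // exprVn.
  rewrite le_eqVlt; apply/orP; left; apply/eqP.
  by field; rewrite expf_neq0 // (gt_eqF r0).
rewrite big_split /= big_split /= !prodrXr.
rewrite ler_wpM2r ?exprn_ge0 // ler_wpM2r ?exprn_ge0 //.
by rewrite -natr_prod ler_nat prod_fact_le.
Qed.

Lemma monomial_dmono a x w : monomial (x - a) w = dmono a (midx0 k) w x.
Proof.
by apply: eq_bigr => i _; rewrite !ffunE ffactn0 mul1r subn0 !mxE.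
Qed.

Lemma msize_incr v u : msize (midx_incr v u) = (msize v).+1.
Proof.
rewrite /msize (eq_bigr (fun i => v i + (i == u))%N); last by move=> i _; rewrite ffunE.
rewrite big_split /= (_ : \sum_i (i == u) = 1)%N ?addn1 //.
by rewrite (bigD1 u) //= eqxx big1 // => i /negPf ->.
Qed.

Lemma msize0 : msize (midx0 k) = 0%N.
Proof. by rewrite /msize big1 // => i _; rewrite ffunE. Qed.

End Monomials.

Section Analytic.
Variables (K : numFieldType) (hK : calculus_field K) (k : nat).
Local Notation pd u G x l := (is_derive x (basis_vec K u) G l).

(** The terms of an unconditionally convergent family are bounded. *)
Lemma summable_bounded (I : choiceType) (b : I -> K) (l : K) :
  partial_sum b @ totally --> l -> exists2 M, 0 < M & forall i, `|b i| <= M.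
Proof.
move=> cv; have FT : Filter (@totally I) by apply: totally_filter.
move/cvgrPdist_lt : cv => /(_ 1 ltr01) [A _ HA].
pose S := \sum_(i <- A) `|b i|.
have S0 : 0 <= S by exact: sumr_ge0.
exists (2 + S) => [|i]; first by rewrite ltr_wpDr.
have ps (B : {fset I}) : partial_sum b B = \sum_(i <- B) b i.
  by rewrite /partial_sum -(big_seq_fsetE _ _ predT b).
have [iA|iA] := boolP (i \in A).
  apply: ler_wpDl => //; rewrite /S (big_fsetD1 i) //= lerDl.
  exact: sumr_ge0.
apply: ler_wpDr => //.
have := HA A (fsubset_refl A); have := HA (i |` A)%fset (fsubsetUr _ _).
rewrite /= !ps big_fsetU1 //= => H1 H2.
have -> : b i = (l - \sum_(j <- A) b j) - (l - (b i + \sum_(j <- A) b j)) by ring.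
apply: le_trans (ler_normB _ _) _.
by rewrite -[2]/(1 + 1) lerD // ltW.
Qed.

(** An analytic function has geometric majorants near each point.  A single
    radius [d] serves as size of the ball and, inverted, as both constants of
    the majorant. *)
Lemma analytic_maj (g : 'rV[K]_k -> K) (a : 'rV[K]_k) : analytic_at g a ->
  exists2 d, 0 < d & forall N, maj (ball a d) d^-1 N g d^-1 0.
Proof.
case=> c /nbhs_ballP[r r0 Hr].
have {}r0 : 0 < r by [].
have r2 : 0 < r / 2 by rewrite divr_gt0.
(* Boundedness of the terms at the diagonal point [x0] bounds the
   coefficients. *)
pose x0 : 'rV[K]_k := a + const_mx (r / 2).
have bx0 : ball a r x0.
  apply/rV_ballP; split => // j; rewrite !mxE opprD addrA subrr sub0r normrN.
  by rewrite gtr0_norm // [ltRHS]splitr ltrDl.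
have [M M0 HM] := summable_bounded (Hr _ bx0).
have Hc w : `|c w| <= M * (r / 2)^-1 ^+ msize w.
  have := HM w; rewrite normrM exprVn ler_pdivlMr ?exprn_gt0 //.
  rewrite [X in _ * X](_ : _ = (r / 2) ^+ msize w) //.
  rewrite /monomial normr_prod /msize -prodrXr; apply: eq_bigr => i _.
  by rewrite !mxE addrAC subrr add0r normrX gtr0_norm.
(* On the ball of radius [R] all differentiated series have ratio
   [2 * R / (r / 2) = 1 / 2]. *)
pose R := r / 8.
have R0 : 0 < R by rewrite divr_gt0.
have q0 : 0 < 2^-1 :> K by rewrite invr_gt0.
have q1 : 2^-1 < 1 :> K by rewrite invf_lt1 // ltr1n.
have bR x : ball a R x -> ball a r x.
  by apply: le_ball; rewrite /R ler_piMr ?(ltW r0) // invf_le1 // ler1n.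
have bF v x : ball a R x ->
    mbounded 2^-1 (M * ((msize v)`!%:R * R^-1 ^+ msize v)) (fun w => c w * dmono a v w x).
  move=> bx w; rewrite normrM.
  have -> : 2^-1 = (r / 2)^-1 * (2 * R).
    by rewrite /R; field; rewrite ?gt_eqF.
  rewrite exprMn mulrACA.
  by apply: ler_pM => //; exact: dmono_norm_le.
pose g' (v : multi_index k) (x : 'rV[K]_k) := msum (fun w => c w * dmono a v w x).
have Rn (v : multi_index k) : 0 <= (msize v)`!%:R * R^-1 ^+ msize v :> K.
  by rewrite mulr_ge0 ?exprn_ge0 // invr_ge0 ltW.
have pg u v x : ball a R x -> pd u (g' v) x (g' (midx_incr v u) x).
  move=> bx.
  pose v1 := midx_incr v u; pose v2 := midx_incr v1 u.
  pose B (v' : multi_index k) := M * ((msize v')`!%:R * R^-1 ^+ msize v').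
  have B0 (v' : multi_index k) : 0 <= B v' by rewrite mulr_ge0 // ltW.
  pose C := B v + B v1 + B v2.
  have wk v' y : B v' <= C -> ball a R y ->
      mbounded 2^-1 C (fun w => c w * dmono a v' w y).
    by move=> BC /(bF v'); exact: (mbounded_weaken (ltW q0) (lexx _) (B0 v') BC).
  have pF v' w y : pd u (fun y => c w * dmono a v' w y) y
      (c w * dmono a (midx_incr v' u) w y).
    exact: is_deriveZ (is_derive_dmono u a v' w y).
  apply: (msum_derive hK (ltW q0) q1 (F := fun w y => c w * dmono a v w y)
   (F' := fun w y => c w * dmono a v1 w y)
   (F'' := fun w y => c w * dmono a v2 w y) (C := C)) bx => //.
  - move=> y; apply: wk; rewrite /C -addrA lerDl addr_ge0 //.
  - move=> y; apply: wk; rewrite /C addrAC lerDr addr_ge0 //.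
  - move=> y; apply: wk; rewrite /C lerDr addr_ge0 //.
have Bo : open (ball a R) by exact: ball_open.
have gg x : ball a R x -> g' (midx0 k) x = g x.
  move=> bx; apply/esym; apply: (msum_totally hK q0 q1 (bF _ _ bx)).
  have := Hr x (bR x bx); rewrite (_ : (fun w => c w * monomial (x - a) w) =
    (fun w => c w * dmono a (midx0 k) w x)) //.
  by apply: funext => w; rewrite monomial_dmono.
pose M' := M / (1 - 2^-1) ^+ k.
have M'0 : 0 < M' by rewrite divr_gt0 // exprn_gt0 // subr_gt0.
have mg N v : maj (ball a R) R^-1 N (g' v) (M' * R^-1 ^+ msize v) (msize v).
  have base w x : ball a R x ->
      `|g' w x| <= M' * R^-1 ^+ msize w * (msize w)`!%:R.
    move=> bx; have [_ H] := msum_spec hK (ltW q0) q1 (bF w x bx).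
    apply: le_trans H _; rewrite /M'; rewrite le_eqVlt; apply/orP; left; apply/eqP.
    by rewrite -mulrA [RHS]mulrAC -!mulrA; congr (M * _); ring.
  elim: N v => [|N IH] v; first by split=> // x; exact: base.
  apply: (maj_step Bo (G' := fun u => g' (midx_incr v u))).
  - by move=> x; exact: base.
  - by move=> u; rewrite -mulrA -exprSr -(msize_incr v u); exact: IH.
have M'i : 0 < M'^-1 by rewrite invr_gt0.
have [d d0 [dR dM]] := exists_pos_le2 R0 M'i.
exists d => // N.
have H0 : maj (ball a R) R^-1 N g M' 0.
  have := mg N (midx0 k); rewrite msize0 expr0 mulr1.
  exact: maj_ext.
apply: maj_weaken H0.
- exact: le_ball.
- by rewrite invr_ge0 ltW.
- by rewrite lef_pV2.
- by rewrite ltW.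
- by rewrite -[M']invrK lef_pV2 // posrE.
Qed.

End Analytic.

(** * Covariant derivatives *)

Lemma finite_uniform_radius (K : numFieldType) (I : finType)
    (Q : I -> K -> Prop) :
  (forall i d d', 0 < d' -> d' <= d -> Q i d -> Q i d') ->
  (forall i, exists2 d, 0 < d & Q i d) -> exists2 d, 0 < d & forall i, Q i d.
Proof.
move=> mono H.
suff [d d0 Hd] : exists2 d, 0 < d & forall i, i \in enum I -> Q i d.
  by exists d => // i; apply: Hd; rewrite mem_enum.
elim: (enum I) => [|i s [d d0 Hd]]; first by exists 1.
have [di di0 Hi] := H i.
have [e e0 [ed edi]] := exists_pos_le2 d0 di0.
exists e => // j; rewrite inE => /orP[/eqP ->|js]; first exact: mono edi Hi.
exact: mono ed (Hd j js).
Qed.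

Section CovariantDerivatives.
Variables (K : numFieldType) (hK : calculus_field K) (n k : nat).
Variable f : 'I_n -> 'I_n -> 'I_k -> 'rV[K]_k -> K.
Local Notation pd u G x l := (is_derive x (basis_vec K u) G l).
Local Notation mfun := ('I_n -> 'I_n -> 'rV[K]_k -> K).
Implicit Types (P Q : mfun) (u v : 'I_k) (w : multi_index k).

(** The covariant derivative along [x_u] of a matrix of functions. *)
Definition cov u P : mfun := fun t s x =>
  partial u (P t s) x + \sum_(p < n) f t p u x * P p s x.

Definition id_mfun : mfun := fun t s _ => (t == s)%:R.

(** The iterated covariant derivative of multi-order [w] of the identity, the
    derivatives being taken in a fixed order of the variables.  These are the
    functions [P] of the theorem. *)
Definition covs w : mfun :=
  foldr (fun u P => iter (w u) (cov u) P) id_mfun (enum 'I_k).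

(** A geometric majorant on [V] common to all coefficients [f]. *)
Definition f_maj (V : set 'rV[K]_k) (A M : K) : Prop :=
  forall r s u N, maj V A N (f r s u) M 0.

(** A matrix of functions whose derivatives are controlled by those of [f] in
    the way an iterated covariant derivative of order [j] is. *)
Definition tame (j : nat) P : Prop := forall V A M, open V -> 0 <= A -> 0 <= M ->
  f_maj V A M -> forall t s N, maj V A N (P t s) ((A + M *+ n) ^+ j) j.

Lemma tame_id : tame 0 id_mfun.
Proof.
move=> V A M Vo A0 M0 fM t s N; rewrite expr0; apply: maj_cst => //.
by rewrite /id_mfun; case: (t == s); rewrite ?normr1 ?normr0.
Qed.

(** Covariant differentiation raises the order by one: the derivative
    contributes the constant [A] and the [n] products contribute [M] each. *)
Lemma tame_cov j u P : tame j P -> tame j.+1 (cov u P).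
Proof.
move=> tP V A M Vo A0 M0 fM t s N.
have B0 : 0 <= (A + M *+ n) ^+ j by rewrite exprn_ge0 // addr_ge0 // mulrn_wge0.
have mp := maj_partial u (tP V A M Vo A0 M0 fM t s N.+1).
have mf p : maj V A N (fun x => f t p u x * P p s x) (M * (A + M *+ n) ^+ j) j.+1.
  apply: (maj_weaken _ A0 (lexx A) _ _
    (majM Vo (fM t p u N) (tP V A M Vo A0 M0 fM p s N))) => //.
    by rewrite divr_ge0 // !mulr_ge0.
  rewrite add0n fact0 mul1n ler_pdivrMr ?ltr0n ?fact_gt0 // ler_wpM2l ?mulr_ge0 //.
  by rewrite ler_nat factS leq_pmull.
have := majD Vo mp (maj_sum (index_enum 'I_n) Vo mf).
have -> : size (index_enum 'I_n) = n.
  by rewrite -sum1_size big_const_ord iter_addn_0 mul1n.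
rewrite [X in maj _ _ _ _ X](_ : _ = (A + M *+ n) ^+ j.+1) //.
by rewrite exprSr mulrDr -mulrnAl [_ * (M *+ n)]mulrC.
Qed.

Lemma tame_iter j m u P : tame j P -> tame (m + j) (iter m (cov u) P).
Proof. by move=> tP; elim: m => [//|m IH]; apply: tame_cov. Qed.

Lemma tame_foldr w (l : seq 'I_k) :
  tame (\sum_(u <- l) w u) (foldr (fun u P => iter (w u) (cov u) P) id_mfun l).
Proof.
elim: l => [|u l IH]; first by rewrite big_nil; exact: tame_id.
by rewrite big_cons; apply: tame_iter.
Qed.

Lemma tame_covs w : tame (msize w) (covs w).
Proof.
have := tame_foldr w (enum 'I_k).
by rewrite /msize big_enum.
Qed.

Lemma covs0 : covs (midx0 k) = id_mfun.
Proof. by rewrite /covs; elim: (enum 'I_k) => //= u l ->; rewrite ffunE. Qed.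

Variable U : set 'rV[K]_k.
Hypothesis hU : open U.
Hypothesis hf : forall r s u x, U x -> analytic_at (f r s u) x.
Hypothesis hint : forall u v t s x, U x -> integrability f t s u v x = 0.

Lemma f_maj_near a : U a ->
  exists2 d : K, 0 < d & ball a d `<=` U /\ f_maj (ball a d) d^-1 d^-1.
Proof.
move=> Ua.
have mono (i : 'I_n * 'I_n * 'I_k) (d d' : K) : 0 < d' -> d' <= d ->
    (forall N, maj (ball a d) d^-1 N (f i.1.1 i.1.2 i.2) d^-1 0) ->
    (forall N, maj (ball a d') d'^-1 N (f i.1.1 i.1.2 i.2) d'^-1 0).
  move=> d'0 d'd H N; have d0 := lt_le_trans d'0 d'd.
  by apply: maj_weaken (H N); rewrite ?lef_pV2 ?posrE ?invr_ge0 ?(ltW d0) //;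
    exact: le_ball.
have [d1 d10 H1] := finite_uniform_radius mono
  (fun i => analytic_maj hK (hf i.1.1 i.1.2 i.2 Ua)).
have /nbhs_ballP[d2 d20 H2] := open_nbhs_nbhs (conj hU Ua).
have [d d0 [dd1 dd2]] := exists_pos_le2 d10 (d20 : 0 < d2).
exists d => //; split; first by move=> x /(le_ball dd2)/H2.
by move=> r s u; have := mono (r, s, u) d1 d d0 dd1 (H1 (r, s, u)).
Qed.

Lemma tame_near j P a : tame j P -> U a ->
  exists2 d : K, 0 < d & ball a d `<=` U /\
    exists c : K, forall t s N, maj (ball a d) d^-1 N (P t s) c j.
Proof.
move=> tP Ua; have [d d0 [dU fd]] := f_maj_near Ua.
exists d => //; split => //; exists ((d^-1 + d^-1 *+ n) ^+ j) => t s N.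
by apply: tP => //; [exact: ball_open|rewrite invr_ge0 ltW|rewrite invr_ge0 ltW].
Qed.

Lemma tame_has_partial j P u t s x : tame j P -> U x -> has_partial u (P t s) x.
Proof.
move=> tP Ux; have [d d0 [_ [c Hc]]] := tame_near tP Ux.
by have [_ /(_ u)[H _]] := Hc t s 1%N; apply: H; exact: ballxx.
Qed.

(** Equality on [U]; the values outside [U] are irrelevant. *)
Definition eq_on_U P Q := forall t s x, U x -> P t s x = Q t s x.

Lemma cov_ext u P Q : eq_on_U P Q -> eq_on_U (cov u P) (cov u Q).
Proof.
move=> PQ t s x Ux; rewrite /cov /partial; congr (_ + _).
  apply: near_eq_derive; have := open_nbhs_nbhs (conj hU Ux).
  by apply: filterS => y; exact: PQ.
by apply: eq_bigr => p _; rewrite PQ.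
Qed.

Lemma partial_cov (V : set 'rV[K]_k) A M j P u v t s x : open V -> 0 <= A ->
  0 <= M -> f_maj V A M -> tame j P -> V x ->
  partial u (cov v P t s) x = partial u (partial v (P t s)) x +
    \sum_(p < n) (partial u (f t p v) x * P p s x +
                  f t p v x * partial u (P p s) x).
Proof.
move=> Vo A0 M0 fM tP Vx.
have mP t' s' N := tP V A M Vo A0 M0 fM t' s' N.
have H1 : pd u (partial v (P t s)) x (partial u (partial v (P t s)) x).
  exact: (maj_pd u (maj_partial v (mP t s 2%N)) Vx).
have H2 p : pd u (f t p v * P p s) x
   (partial u (f t p v) x * P p s x + f t p v x * partial u (P p s) x).
  have := is_deriveM (maj_pd u (fM t p v 1%N) Vx) (maj_pd u (mP p s 1%N) Vx).
  by rewrite /GRing.scale /= addrC [P p s x * _]mulrC.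
have E : cov v P t s = partial v (P t s) + \sum_(p < n) f t p v * P p s.
  by apply: funext => y; rewrite /cov; congr (_ + _); rewrite fct_sumE.
rewrite E; have [_ D] := is_deriveD H1 (is_derive_sum H2).
exact: D.
Qed.

(** Covariant derivatives commute: their commutator is multiplication by the
    curvature [integrability f], which vanishes on [U]. *)
Lemma cov_comm j P u v : tame j P ->
  eq_on_U (cov u (cov v P)) (cov v (cov u P)).
Proof.
move=> tP t s x Ux.
have [d d0 [dU fd]] := f_maj_near Ux.
have Vo : open (ball x d) by exact: ball_open.
have di : 0 <= d^-1 by rewrite invr_ge0 ltW.
have bx : ball x d x by exact: ballxx.
have mP t' s' N := tP _ _ _ Vo di di fd t' s' N.
have E u1 v1 : cov u1 (cov v1 P) t s x =
    partial u1 (partial v1 (P t s)) x +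
    (\sum_(p < n) (f t p v1 x * partial u1 (P p s) x
                 + f t p u1 x * partial v1 (P p s) x)
   + \sum_(q < n) (partial u1 (f t q v1) x
                 + \sum_(p < n) f t p u1 x * f p q v1 x) * P q s x).
  rewrite {1}/cov (partial_cov _ _ _ _ Vo di di fd tP bx) -addrA.
  apply: congr1; rewrite -big_split /=.
  rewrite (eq_bigr (fun p => (f t p v1 x * partial u1 (P p s) x
       + f t p u1 x * partial v1 (P p s) x) + (partial u1 (f t p v1) x * P p s x
       + \sum_(q < n) f t p u1 x * f p q v1 x * P q s x))); last first.
    move=> p _; rewrite /cov mulrDr mulr_sumr.
    under [in RHS]eq_bigr => q _ do rewrite -mulrA.
    by rewrite [partial _ _ _ * _ + _]addrC -!addrA; apply: congr1;
      rewrite addrCA.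
  rewrite big_split /=; apply: congr1; rewrite big_split /= exchange_big /=.
  rewrite -big_split /=; apply: eq_bigr => q _.
  by rewrite mulrDl mulr_suml.
rewrite (E u v) (E v u).
have -> : partial u (partial v (P t s)) x = partial v (partial u (P t s)) x.
  have m1 := mP t s 3%N.
  pose B := (d^-1 + d^-1 *+ n) ^+ j / d / d / d * (j.+3)`!%:R.
  have third u1 u2 u3 y : ball x d y ->
      pd u3 (partial u2 (partial u1 (P t s))) y
        (partial u3 (partial u2 (partial u1 (P t s))) y) /\
      `|partial u3 (partial u2 (partial u1 (P t s))) y| <= B.
    move=> hy; have m2 := maj_partial u2 (maj_partial u1 m1).
    split; first exact: maj_pd m2 hy.
    exact: maj_bound (maj_partial u3 m2) _ hy.
  have first u1 y : ball x d y -> pd u1 (P t s) y (partial u1 (P t s) y).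
    exact: maj_pd m1.
  have second u1 u2 y : ball x d y -> pd u2 (partial u1 (P t s)) y
      (partial u2 (partial u1 (P t s)) y).
    exact: maj_pd (maj_partial u1 m1).
  exact: (mixed_partialsC hK (first v) (first u) (second v u) (second u v)
    (third v u v) (third v u u) (third u v u) (third u v v) bx).
apply: congr1; apply: congr2.
  by apply: eq_bigr => p _; rewrite addrC.
apply: eq_bigr => q _; congr (_ * _).
apply/eqP; rewrite -subr_eq0; apply/eqP.
by rewrite -[RHS](hint u v t q Ux) /integrability opprD addrACA addrA.
Qed.

Lemma iter_cov_comm j m u v P : tame j P ->
  eq_on_U (iter m (cov v) (cov u P)) (cov u (iter m (cov v) P)).
Proof.
move=> tP; elim: m => [//|m IH] t s x Ux /=.
rewrite (cov_ext v IH) // (@cov_comm (m + j)) //.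
exact: tame_iter.
Qed.

Lemma iter_cov_ext m u P Q : eq_on_U P Q ->
  eq_on_U (iter m (cov u) P) (iter m (cov u) Q).
Proof. by move=> PQ; elim: m => [//|m IH]; exact: cov_ext. Qed.

Lemma covs_incr w u : eq_on_U (covs (midx_incr w u)) (cov u (covs w)).
Proof.
rewrite /covs; have := mem_enum 'I_k u; rewrite inE.
have := enum_uniq 'I_k; elim: (enum 'I_k) => [//|v l IH] /= /andP[vl ul].
rewrite inE ffunE; case: (eqVneq u v) => [uv|uv] /= => [_|ul'].
  rewrite -uv addn1.
  suff -> : foldr (fun u0 P => iter (midx_incr w u u0) (cov u0) P) id_mfun l
    = foldr (fun u0 P => iter (w u0) (cov u0) P) id_mfun l by [].
  move: vl; rewrite -uv; elim: (l) => [//|v' l' IH'] /=.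
  rewrite inE negb_or ffunE => /andP[uv' /IH' ->].
  by rewrite eq_sym (negPf uv') addn0.
rewrite addn0 => t s x Ux.
rewrite (iter_cov_ext _ v (IH ul ul')) //.
by rewrite (iter_cov_comm _ _ _ (tame_foldr w l)).
Qed.

End CovariantDerivatives.

(** * The fundamental solution *)

Lemma multinomial_le (k : nat) (w : multi_index k) :
  ((msize w)`! <= (2 ^ k) ^ msize w * \prod_i (w i)`!)%N.
Proof.
have H (s : seq 'I_k) : ((\sum_(i <- s) w i)`! <=
    (2 ^ size s) ^ (\sum_(i <- s) w i) * \prod_(i <- s) (w i)`!)%N.
  elim: s => [|i s IH]; first by rewrite !big_nil.
  rewrite !big_cons /=; set b := (\sum_(j <- s) w j)%N in IH *.
  rewrite -(bin_fact (leq_addr b (w i))) addKn.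
  apply: (@leq_trans (2 ^ (w i + b) * ((w i)`! * ((2 ^ size s) ^ b
      * \prod_(j <- s) (w j)`!)))%N).
    by rewrite leq_mul ?bin_le_expn2 // leq_mul2l IH orbT.
  set F := (w i)`!; set Q := (\prod_(j <- s) (w j)`!)%N.
  have -> : (2 ^ (w i + b) * (F * ((2 ^ size s) ^ b * Q)) =
      2 ^ (w i + b) * (2 ^ size s) ^ b * (F * Q))%N by ring.
  rewrite leq_mul2r; apply/orP; right.
  rewrite -!expnM -expnD leq_exp2l // mulSn.
  by rewrite leq_add2l leq_mul2l leq_addl orbT.
have := H (index_enum 'I_k).
by rewrite -[size _]sum1_size big_const_ord iter_addn_0 mul1n.
Qed.

Lemma fact_add2_le j : ((j.+2)`! <= 2 * 4 ^ j * j`!)%N.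
Proof.
rewrite !factS mulnA leq_mul2r; apply/orP; right.
have H : (j < 2 ^ j)%N by rewrite ltn_expl.
have -> : (2 * 4 ^ j = (2 * 2 ^ j) * 2 ^ j)%N by rewrite -mulnA -expnMn.
apply: leq_mul => //; rewrite mul2n -addnn -addn1.
by apply: leq_add => //; rewrite expn_gt0.
Qed.

Lemma msum_sum (K : numFieldType) (hK : calculus_field K) (k : nat)
    (I : Type) (l : seq I) (c : I -> K) (a : I -> multi_index k -> K) (q C : K) :
  0 <= q -> q < 1 -> (forall i, mbounded q C (a i)) ->
  (exists D, mbounded q D (fun w => \sum_(i <- l) c i * a i w)) /\
  msum (fun w => \sum_(i <- l) c i * a i w) = \sum_(i <- l) c i * msum (a i).
Proof.
move=> q0 q1 Ha; elim: l => [|i l [[D HD] IH]].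
  split; first by exists 0 => w; rewrite big_nil normr0 mul0r.
  by rewrite big_nil -[RHS](msum0 K k); apply: eq_msum => w; rewrite big_nil.
have Hi := mboundedZ (c i) (Ha i).
split.
  exists (`|c i| * C + D) => w; rewrite big_cons; exact: mboundedD Hi HD w.
rewrite big_cons -IH -(msumZ hK (c i) q0 q1 (Ha i)) -(msumD hK q0 q1 Hi HD).
by apply: eq_msum => w; rewrite big_cons.
Qed.

Section ExponentialMonomials.
Variables (K : numFieldType) (k : nat).
Implicit Types (x : 'rV[K]_k) (u : 'I_k) (w v : multi_index k).
Local Notation pd u G x l := (is_derive x (basis_vec K u) G l).

(** [emono v w] is the partial derivative of multi-order [v] of
    [(- x) ^ w / w`!]. *)
Definition emono v w x : K :=
  (\prod_i ((-1) ^+ w i / (w i)`!%:R)) * dmono 0 v w x.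

Lemma emono0 w x :
  emono (midx0 k) w x = \prod_i ((- x 0 i) ^+ w i / (w i)`!%:R).
Proof.
rewrite /emono /dmono -big_split; apply: eq_bigr => i _ /=.
by rewrite ffunE ffactn0 mul1r subn0 mxE subr0 [in RHS]exprNn mulrAC.
Qed.

(** Differentiation lowers an exponent and changes the sign; this makes the
    differentiated series telescope. *)
Lemma emono1 u w x : emono (midx_incr (midx0 k) u) w x =
  if w u is _.+1 then - emono (midx0 k) (midx_decr w u) x else 0.
Proof.
case E : (w u) => [|m].
  rewrite /emono /dmono [X in _ * X](bigD1 u) //= E !ffunE eqxx add0n ffactn1.
  by rewrite mul0r mul0r mulr0.
rewrite emono0 /emono /dmono -big_split (bigD1 u) //= [in RHS](bigD1 u) //=.
rewrite -mulNr E !ffunE eqxx /= add0n ffactn1 E !subn1 /= mxE subr0; congr (_ * _).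
  rewrite factS natrM exprS [in RHS]exprNn.
  have f0 : m`!%:R != 0 :> K by rewrite pnatr_eq0 -lt0n fact_gt0.
  have f1 : m.+1%:R != 0 :> K by rewrite pnatr_eq0.
  by field; rewrite f0 nat1r f1.
apply: eq_bigr => i iu.
rewrite !ffunE (negPf iu) ffactn0 mul1r !subn0 mxE subr0.
by rewrite [in RHS]exprNn mulrAC.
Qed.

Lemma is_derive_emono u v w x :
  pd u (emono v w) x (emono (midx_incr v u) w x).
Proof.
exact: (is_deriveZ (\prod_i ((-1) ^+ w i / (w i)`!%:R)) (is_derive_dmono u 0 v w x)).
Qed.

Lemma emono_norm_le v w x (r : K) : ball 0 r x ->
  `|emono v w x| <= (msize v)`!%:R * r^-1 ^+ msize v * (2 * r) ^+ msize w
                     / (\prod_i (w i)`!)%:R.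
Proof.
move=> bx; rewrite /emono normrM mulrC [X in _ * X](_ : _ = (\prod_i (w i)`!)%:R^-1).
  by rewrite ler_wpM2r ?invr_ge0 // dmono_norm_le.
rewrite normr_prod natr_prod -prodfV; apply: eq_bigr => i _.
by rewrite normrM normrX normrN1 expr1n mul1r normfV ger0_norm.
Qed.

Lemma midx_decrK u w m : w u = m.+1 -> midx_incr (midx_decr w u) u = w.
Proof.
move=> E; apply/ffunP => i; rewrite !ffunE; case: eqP => [->|_].
  by rewrite E subn1 addn1.
by rewrite subn0 addn0.
Qed.

End ExponentialMonomials.

Section FundamentalSolution.
Variables (K : numFieldType) (hK : calculus_field K) (n k : nat).
Variable f : 'I_n -> 'I_n -> 'I_k -> 'rV[K]_k -> K.
Local Notation pd u G x l := (is_derive x (basis_vec K u) G l).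
Variable U : set 'rV[K]_k.
Hypothesis hU : open U.
Hypothesis U0 : U 0.
Hypothesis hf : forall r s u x, U x -> analytic_at (f r s u) x.
Hypothesis hint : forall u v t s x, U x -> integrability f t s u v x = 0.

Let P := covs f.

(** The terms of the series for the fundamental matrix. *)
Definition fterm (r s : 'I_n) (x : 'rV[K]_k) (w : multi_index k) : K :=
  (\prod_(i < k) ((- x 0 i) ^+ w i / (w i)`!%:R)) * covs f w r s x.

Definition fundamental (r s : 'I_n) (x : 'rV[K]_k) : K := msum (fterm r s x).

(** The series [fundamental] is a solution matrix with value the identity at
    the origin, on a ball where its terms are dominated by the geometric series
    of ratio 1/2. *)
Lemma fundamental_solution : exists2 rho : K, 0 < rho &
  ball (0 : 'rV[K]_k) rho `<=` U /\
  [/\ exists C : K, forall r s x, ball (0 : 'rV[K]_k) rho x ->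
        mbounded 2^-1 C (fterm r s x),
      forall r s u x, ball (0 : 'rV[K]_k) rho x ->
        pd u (fundamental r s) x
           (- \sum_(p < n) f r p u x * fundamental p s x)
    & forall r s, fundamental r s 0 = (r == s)%:R].
Proof.
have [d d0 [dU fd]] := f_maj_near hK hU hf U0.
pose A := d^-1; pose B := A + A *+ n.
have A0 : 0 <= A by rewrite invr_ge0 ltW.
have B0 : 0 <= B by rewrite addr_ge0 // mulrn_wge0.
have kB : 0 < 2 ^+ (k + 4) * (B + 1) by rewrite mulr_gt0 ?exprn_gt0 // ltr_wpDl.
have kBi : 0 < (2 ^+ (k + 4) * (B + 1))^-1 by rewrite invr_gt0.
(* The radius makes the ratio at most 1/2: a term of degree [j] is bounded by a
   constant times [(2 ^+ k * 4 * (2 * R) * B) ^+ j], with [2 ^+ k] from the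
   multinomial coefficients, [4] from [j.+2`! / j`!] and [2] from
   differentiating the monomial. *)
have [R R0 [Rd RB]] := exists_pos_le2 d0 kBi.
have q0 : 0 <= 2^-1 :> K by rewrite invr_ge0.
have q1 : 2^-1 < 1 :> K by rewrite invf_lt1 // ltr1n.
have qB : 2 ^+ k * 4 * (2 * R) * B <= 2^-1.
  have h : R * (2 ^+ (k + 4) * (B + 1)) <= 1 by rewrite -ler_pdivlMr // div1r.
  rewrite -[_^-1]mul1r ler_pdivlMr //; apply: le_trans h.
  have -> : 2 ^+ k * 4 * (2 * R) * B * 2 = R * (2 ^+ (k + 4) * B).
    by rewrite exprD; ring.
  by rewrite !ler_wpM2l ?(ltW R0) ?exprn_ge0 // lerDl ler01.
have Vo : open (ball (0 : 'rV[K]_k) d) by exact: ball_open.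
have mP w r s N : maj (ball 0 d) A N (P w r s) (B ^+ msize w) (msize w).
  exact: (@tame_covs K n k f w _ _ _ Vo A0 A0 fd r s N).
have bd x : ball (0 : 'rV[K]_k) R x -> ball 0 d x by exact: le_ball.
have Ri : 0 <= R^-1 by rewrite invr_ge0 ltW.
(* The common estimate for all products of a derivative of the monomial and a
   derivative of [P w]. *)
have prod_le (v w : multi_index k) (x : 'rV[K]_k) (b beta : K) :
    ball 0 R x -> 0 <= beta ->
    `|b| <= beta * B ^+ msize w * (msize w).+2`!%:R ->
    `|emono v w x * b| <=
      (msize v)`!%:R * R^-1 ^+ msize v * beta * 2 * 2^-1 ^+ msize w.
  move=> bx beta0 hb; rewrite normrM.
  set j := msize w in hb *; set pw := (\prod_i (w i)`!)%N.
  have pw0 : 0 < pw%:R :> K by rewrite ltr0n prodn_gt0 // => i; rewrite fact_gt0.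
  set al := (msize v)`!%:R * R^-1 ^+ msize v.
  have al0 : 0 <= al by rewrite mulr_ge0 // exprn_ge0.
  apply: le_trans (ler_pM _ _ (emono_norm_le v w bx) hb) _ => //.
  rewrite -/al -/j -/pw.
  have -> : al * (2 * R) ^+ j / pw%:R * (beta * B ^+ j * j.+2`!%:R)
     = al * beta * ((2 * R) ^+ j * B ^+ j * (j.+2`!%:R / pw%:R)).
    by field; rewrite gt_eqF.
  have ab0 : 0 <= al * beta by exact: mulr_ge0.
  rewrite -[leRHS]mulrA (ler_wpM2l ab0) //.
  have h : j.+2`!%:R / pw%:R <= 2 * (2 ^+ k * 4) ^+ j :> K.
    rewrite ler_pdivrMr // -natrX -natrM -natrX -!natrM ler_nat.
    apply: leq_trans (fact_add2_le j) _.
    have MN : (j`! <= (2 ^ k) ^ j * pw)%N by exact: multinomial_le.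
    apply: leq_trans (leq_mul (leqnn _) MN) _.
    rewrite expnMn.
    by have -> : (2 * 4 ^ j * ((2 ^ k) ^ j * pw) = 2 * ((2 ^ k) ^ j * 4 ^ j) * pw)%N
      by ring.
  apply: (@le_trans _ _ ((2 * R) ^+ j * B ^+ j * (2 * (2 ^+ k * 4) ^+ j))).
    by rewrite ler_wpM2l // mulr_ge0 ?exprn_ge0 // mulr_ge0 // ltW.
  have -> : (2 * R) ^+ j * B ^+ j * (2 * (2 ^+ k * 4) ^+ j)
      = 2 * (2 ^+ k * 4 * (2 * R) * B) ^+ j.
    by rewrite -exprMn mulrCA -exprMn; congr (_ * _ ^+ _); ring.
  rewrite ler_wpM2l // lerXn2r // nnegrE.
  by rewrite !mulr_ge0 ?exprn_ge0 // ltW.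
have bPp (w : multi_index k) r s x : ball (0 : 'rV[K]_k) R x ->
    `|P w r s x| <= 1 * B ^+ msize w * (msize w).+2`!%:R.
  move=> /bd bx; apply: le_trans (maj_bound (mP w r s 0%N) bx) _.
  rewrite mul1r ler_wpM2l ?exprn_ge0 // ler_nat.
  by rewrite (leq_trans (_ : _ <= (msize w).+1`!)%N) // factS leq_pmull.
have bPp1 (w : multi_index k) r s (u : 'I_k) x : ball (0 : 'rV[K]_k) R x ->
    `|partial u (P w r s) x| <= A * B ^+ msize w * (msize w).+2`!%:R.
  move=> /bd bx.
  apply: le_trans (maj_bound (maj_partial u (mP w r s 1%N)) bx) _.
  rewrite [A * _]mulrC ler_wpM2l ?mulr_ge0 ?exprn_ge0 // ler_nat.
  by rewrite factS leq_pmull.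
have bPp2 (w : multi_index k) r s (u : 'I_k) x : ball (0 : 'rV[K]_k) R x ->
    `|partial u (partial u (P w r s)) x|
      <= A ^+ 2 * B ^+ msize w * (msize w).+2`!%:R.
  move=> /bd bx.
  have -> : A ^+ 2 * B ^+ msize w = B ^+ msize w * A * A by ring.
  exact: maj_bound (maj_partial u (maj_partial u (mP w r s 2%N))) _ bx.
have bPS (w : multi_index k) r s (u : 'I_k) x : ball (0 : 'rV[K]_k) R x ->
    `|P (midx_incr w u) r s x| <= B * B ^+ msize w * (msize w).+2`!%:R.
  move=> /bd bx; apply: le_trans (maj_bound (mP (midx_incr w u) r s 0%N) bx) _.
  rewrite msize_incr -exprS ler_wpM2l ?exprn_ge0 // ler_nat.
  by rewrite factS leq_pmull.
pose E := R^-1 + A + B + 1.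
have RA : 0 <= R^-1 + A by exact: addr_ge0.
have RB0 : 0 <= R^-1 + B by exact: addr_ge0.
have AB : 0 <= A + B by exact: addr_ge0.
have E1 : 1 <= E by rewrite /E lerDr; exact: addr_ge0.
pose e0 (w : multi_index k) (x : 'rV[K]_k) := emono (midx0 k) w x : K.
pose e1 (u : 'I_k) (w : multi_index k) (x : 'rV[K]_k) :=
  emono (midx_incr (midx0 k) u) w x : K.
pose e2 (u : 'I_k) (w : multi_index k) (x : 'rV[K]_k) :=
  emono (midx_incr (midx_incr (midx0 k) u) u) w x : K.
have b0 (w : multi_index k) (x : 'rV[K]_k) (b beta : K) : ball 0 R x -> 0 <= beta ->
    `|b| <= beta * B ^+ msize w * (msize w).+2`!%:R ->
    `|e0 w x * b| <= beta * 2 * 2^-1 ^+ msize w.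
  move=> bx be hb; have := prod_le (midx0 k) w x b beta bx be hb.
  by rewrite msize0 fact0 expr0 !mul1r.
have b1 (u : 'I_k) (w : multi_index k) (x : 'rV[K]_k) (b beta : K) :
    ball 0 R x -> 0 <= beta ->
    `|b| <= beta * B ^+ msize w * (msize w).+2`!%:R ->
    `|e1 u w x * b| <= R^-1 * beta * 2 * 2^-1 ^+ msize w.
  move=> bx be hb; have := prod_le (midx_incr (midx0 k) u) w x b beta bx be hb.
  by rewrite msize_incr msize0 factS fact0 mul1n expr1 mul1r.
have b2 (u : 'I_k) (w : multi_index k) (x : 'rV[K]_k) (b beta : K) :
    ball 0 R x -> 0 <= beta ->
    `|b| <= beta * B ^+ msize w * (msize w).+2`!%:R ->
    `|e2 u w x * b| <= 2 * R^-1 ^+ 2 * beta * 2 * 2^-1 ^+ msize w.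
  move=> bx be hb.
  have := prod_le (midx_incr (midx_incr (midx0 k) u) u) w x b beta bx be hb.
  by rewrite !msize_incr msize0.
have A20 : 0 <= A ^+ 2 by rewrite exprn_ge0.
(* The terms of the series and their first two partial derivatives along
   [x_u]. *)
pose F r s (w : multi_index k) (x : 'rV[K]_k) := e0 w x * P w r s x.
pose F1 r s (u : 'I_k) (w : multi_index k) (x : 'rV[K]_k) :=
  e1 u w x * P w r s x + e0 w x * partial u (P w r s) x.
pose F2 r s (u : 'I_k) (w : multi_index k) (x : 'rV[K]_k) :=
  (e2 u w x * P w r s x + e1 u w x * partial u (P w r s) x) +
  (e1 u w x * partial u (P w r s) x + e0 w x * partial u (partial u (P w r s)) x).
have EE (a b : K) : 0 <= a -> a <= E -> 0 <= b -> b <= E -> a * b <= E ^+ 2.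
  by move=> a0 aE b0' bE; rewrite expr2 ler_pM.
have RE : R^-1 <= E.
  have -> : E = R^-1 + (A + B + 1) by rewrite /E !addrA.
  by rewrite lerDl; exact: addr_ge0.
have AE : A <= E.
  have -> : E = A + (R^-1 + B + 1) by rewrite /E; ring.
  by rewrite lerDl; exact: addr_ge0.
have BE : B <= E.
  have -> : E = B + (R^-1 + A + 1) by rewrite /E; ring.
  by rewrite lerDl; exact: addr_ge0.
have E2 : 1 <= E ^+ 2 by rewrite exprn_ege1.
have E0 : 0 <= E by exact: le_trans E1.
have E20 : 0 <= E ^+ 2 by rewrite exprn_ge0.
have sum_le (a b : K) c1 c2 c w : `|a| <= c1 * 2 * 2^-1 ^+ msize (w : multi_index k) ->
    `|b| <= c2 * 2 * 2^-1 ^+ msize w -> c1 + c2 <= c * E ^+ 2 ->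
    `|a + b| <= c * E ^+ 2 * 2 * 2^-1 ^+ msize w.
  move=> ha hb hc; apply: le_trans (ler_normD _ _) _.
  apply: le_trans (lerD ha hb) _; rewrite -!mulrDl.
  by rewrite !ler_wpM2r // exprn_ge0.
have bF r s x : ball 0 R x -> mbounded 2^-1 (5 * E ^+ 2 * 2) (fun w => F r s w x).
  move=> bx w; have := b0 w x _ 1 bx ler01 (bPp w r s x bx).
  move/le_trans; apply; rewrite !ler_wpM2r ?exprn_ge0 //.
  by apply: (le_trans E2); rewrite ler_peMl // ler1n.
have Ae := EE _ _ ler01 E1 A0 AE; rewrite mul1r in Ae.
have Re := EE _ _ ler01 E1 Ri RE; rewrite mul1r in Re.
have Be := EE _ _ ler01 E1 B0 BE; rewrite mul1r in Be.
have bF1 r s u x : ball 0 R x ->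
    mbounded 2^-1 (5 * E ^+ 2 * 2) (fun w => F1 r s u w x).
  move=> bx w; apply: sum_le.
  - exact: b1 u w x _ _ bx ler01 (bPp w r s x bx).
  - exact: b0 w x _ _ bx A0 (bPp1 w r s u x bx).
  - rewrite mulr1; apply: le_trans (lerD Re Ae) _.
    have -> : 5 * E ^+ 2 = (E ^+ 2 + E ^+ 2) + 3 * E ^+ 2 by ring.
    by rewrite lerDl mulr_ge0.
have bF2 r s u x : ball 0 R x ->
    mbounded 2^-1 (5 * E ^+ 2 * 2) (fun w => F2 r s u w x).
  move=> bx w.
  have q2 : 0 <= 2 * 2^-1 ^+ msize w :> K by rewrite mulr_ge0 // exprn_ge0.
  have t1 := b2 u w x _ _ bx ler01 (bPp w r s x bx).
  have t2 := b1 u w x _ _ bx A0 (bPp1 w r s u x bx).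
  have t3 := b0 w x _ _ bx A20 (bPp2 w r s u x bx).
  have h1 : 2 * R^-1 ^+ 2 * 1 + R^-1 * A + (R^-1 * A + A ^+ 2) <= 5 * E ^+ 2.
    have -> : 5 * E ^+ 2 = (2 * E ^+ 2) + E ^+ 2 + (E ^+ 2 + E ^+ 2) by ring.
    rewrite mulr1; apply: lerD; apply: lerD; rewrite ?ler_wpM2l // expr2; exact: EE.
  apply: le_trans (ler_normD _ _) _.
  apply: le_trans (lerD (le_trans (ler_normD _ _) (lerD t1 t2))
                        (le_trans (ler_normD _ _) (lerD t2 t3))) _.
  rewrite -!mulrDl; apply: ler_wpM2r; first by rewrite exprn_ge0.
  have -> : (R^-1 + A) * A = R^-1 * A + A ^+ 2 by ring.
  by apply: ler_wpM2r => //; exact: h1.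
have bRU x : ball (0 : 'rV[K]_k) R x -> U x by move=> /bd/dU.
have pP w r s u x : ball 0 R x -> pd u (P w r s) x (partial u (P w r s) x).
  by move=> /bd bx; exact: maj_pd (mP w r s 1%N) bx.
have pP1 w r s u x : ball 0 R x ->
    pd u (partial u (P w r s)) x (partial u (partial u (P w r s)) x).
  by move=> /bd bx; exact: maj_pd (maj_partial u (mP w r s 2%N)) bx.
have pF r s u w x : ball 0 R x -> pd u (F r s w) x (F1 r s u w x).
  move=> bx.
  have := is_deriveM (is_derive_emono u (midx0 k) w x) (pP w r s u x bx).
  by rewrite /GRing.scale /= addrC [P w r s x * _]mulrC.
have pF1 r s u w x : ball 0 R x -> pd u (F1 r s u w) x (F2 r s u w x).
  move=> bx; apply: is_deriveD.
    have := is_deriveM (is_derive_emono u (midx_incr (midx0 k) u) w x)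
      (pP w r s u x bx).
    by rewrite /GRing.scale /= addrC [P w r s x * _]mulrC.
  have := is_deriveM (is_derive_emono u (midx0 k) w x) (pP1 w r s u x bx).
  by rewrite /GRing.scale /= addrC [partial u (P w r s) x * _]mulrC.
have FE r s x : fterm r s x = (fun w => F r s w x).
  by apply: funext => w; rewrite /fterm /F /e0 emono0.
exists R => //; split; first by move=> x /bRU.
split.
- by exists (5 * E ^+ 2 * 2) => r s x bx; rewrite FE; exact: bF.
- move=> r s u x bx.
  have D := msum_derive hK q0 q1 (pF r s u) (pF1 r s u) (bF r s) (bF1 r s u)
    (bF2 r s u) (fun y _ => congr1 (@msum K k) (FE r s y)) bx.
  suff <- : msum (fun w => F1 r s u w x) =
      - (\sum_(p < n) f r p u x * fundamental p s x) by exact: D.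
  (* The differentiated term is [T w], minus its shift [S w], minus the terms
     of the right-hand side; the first two cancel after summation. *)
  pose T (w : multi_index k) := e0 w x * P (midx_incr w u) r s x.
  pose S (w : multi_index k) := if w u is _.+1 then T (midx_decr w u) else 0.
  have SE w : S w = - (e1 u w x * P w r s x).
    rewrite /S /T /e1 emono1; case Ew : (w u) => [|m]; first by rewrite mul0r oppr0.
    by rewrite (midx_decrK Ew) mulNr opprK.
  have bT : mbounded 2^-1 (B * 2) T.
    by move=> w; apply: b0 => //; exact: bPS.
  have bS : mbounded 2^-1 (R^-1 * 1 * 2) S.
    by move=> w; rewrite SE normrN; apply: b1 => //; exact: bPp.
  have [[D1 bD1] sD1] := msum_sum hK (index_enum 'I_n) (fun p => f r p u x)
    q0 q1 (fun p => bF p s x bx).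
  have bS' := mboundedZ (-1) bS; have bD1' := mboundedZ (-1) bD1.
  have F1E w : F1 r s u w x = T w + (-1 * S w +
      -1 * \sum_(p < n) f r p u x * F p s w x).
    have := covs_incr hK hU hf hint w u r s (bRU x bx).
    rewrite -/P /cov => PE.
    rewrite SE /F1 /T PE mulN1r opprK mulrDr mulN1r.
    rewrite (_ : e0 w x * \sum_(p < n) f r p u x * P w p s x =
      \sum_(p < n) f r p u x * F p s w x).
      by rewrite addrCA; congr (_ + _); rewrite addrK.
    by rewrite mulr_sumr; apply: eq_bigr => p _; rewrite /F mulrCA.
  rewrite (eq_msum F1E) (msumD hK q0 q1 bT (mboundedD bS' bD1')).
  rewrite (msumD hK q0 q1 bS' bD1') (msumZ hK _ q0 q1 bS) (msumZ hK _ q0 q1 bD1).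
  rewrite (msum_shift hK u q0 q1 bT) mulN1r addNKr mulN1r sD1.
  by congr (- _); apply: eq_bigr => p _; rewrite /fundamental FE.
- move=> r s; rewrite /fundamental -[RHS](msum_delta (midx0 k)).
  apply: eq_msum => w; rewrite /fterm; case: eqP => [->|w0].
    rewrite big1 ?mul1r; last by move=> i _; rewrite ffunE expr0 fact0 divr1.
    by rewrite covs0.
  have [i wi] : exists i, w i != 0%N.
    case: (pickP (fun i => w i != 0%N)) => [i wi|H]; first by exists i.
    by case: w0; apply/ffunP => i; rewrite ffunE; apply/eqP/negbFE/H.
  by rewrite (bigD1 i) //= mxE oppr0 expr0n (negPf wi) !mul0r.
Qed.

End FundamentalSolution.

(** * Uniqueness *)

Lemma analytic_opp (K : numFieldType) (k : nat) (g : 'rV[K]_k -> K) a :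
  analytic_at g a -> analytic_at (fun x => - g x) a.
Proof.
case=> c Hc; exists (fun w => - c w); apply: filterS Hc => x Hx.
have FT : Filter (@totally (multi_index k)) by apply: totally_filter.
rewrite (_ : partial_sum _ = - partial_sum (fun w => c w * monomial (x - a) w)).
  exact: cvgN.
apply: funext => A.
transitivity (- partial_sum (fun w => c w * monomial (x - a) w) A) => //.
rewrite /partial_sum -sumrN.
by apply: eq_bigr => i _; rewrite mulNr.
Qed.

Section Uniqueness.
Variables (K : numFieldType) (hK : calculus_field K) (n k : nat).
Variable f : 'I_n -> 'I_n -> 'I_k -> 'rV[K]_k -> K.
Local Notation pd u G x l := (is_derive x (basis_vec K u) G l).
Variable U : set 'rV[K]_k.
Hypothesis hU : open U.
Hypothesis hf : forall r s u x, U x -> analytic_at (f r s u) x.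
Hypothesis hint : forall u v t s x, U x -> integrability f t s u v x = 0.

(** The coefficients of the adjoint system: the negated transpose of [f]. *)
Definition adjoint_coef : 'I_n -> 'I_n -> 'I_k -> 'rV[K]_k -> K :=
  fun r s u x => - f s r u x.

Lemma adjoint_analytic r s u x : U x -> analytic_at (adjoint_coef r s u) x.
Proof. by move=> Ux; exact: analytic_opp (hf s r u Ux). Qed.

Lemma adjoint_integrability u v t s x : U x ->
  integrability adjoint_coef t s u v x = 0.
Proof.
move=> Ux; have [d d0 [dU fd]] := f_maj_near hK hU hf Ux.
have bx : ball x d x by exact: ballxx.
have D r' s' u' v' : partial u' (adjoint_coef r' s' v') x
    = - partial u' (f s' r' v') x.
  by have [_] := is_deriveN (maj_pd u' (fd s' r' v' 1%N) bx).
rewrite -[RHS]oppr0 -(hint u v s t Ux) /integrability !D.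
have S u' v' : \sum_(p < n) adjoint_coef t p u' x * adjoint_coef p s v' x =
    \sum_(p < n) f s p v' x * f p t u' x.
  by apply: eq_bigr => p _; rewrite mulrNN mulrC.
by rewrite !S; ring.
Qed.

(** The transpose of the fundamental matrix of the adjoint system is a left
    integrating factor: its product with a solution is constant. *)
Lemma adjoint_integrating_factor (rho : K) (Z : 'I_n -> 'I_n -> 'rV[K]_k -> K)
    (z : 'I_n -> 'rV[K]_k -> K) :
  (forall t r u x, ball (0 : 'rV[K]_k) rho x ->
     pd u (Z t r) x (- \sum_(p < n) adjoint_coef t p u x * Z p r x)) ->
  (forall t r, Z t r 0 = (t == r)%:R) ->
  (forall t u x, ball (0 : 'rV[K]_k) rho x ->
     pd u (z t) x (- \sum_(s < n) f t s u x * z s x)) ->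
  forall r x, ball (0 : 'rV[K]_k) rho x -> \sum_(t < n) Z t r x * z t x = z r 0.
Proof.
move=> pZ Z0 pz r x bx.
rewrite (zero_partials_constant (G := fun x => \sum_(t < n) Z t r x * z t x) hK _ bx).
  rewrite (bigD1 r) //= big1 ?addr0; first by rewrite Z0 eqxx mul1r.
  by move=> t tr; rewrite Z0 (negPf tr) mul0r.
move=> u y hy.
have D := is_derive_sum (fun t => is_deriveM (pZ t r u y hy) (pz t u y hy)).
rewrite (_ : (fun x => \sum_(t < n) Z t r x * z t x) =
  \sum_(t < n) Z t r * z t); last first.
  by apply: funext => y'; rewrite fct_sumE.
suff <- : \sum_(t < n) (Z t r y *: - (\sum_(s < n) f t s u y * z s y)
   + z t y *: - (\sum_(p < n) adjoint_coef t p u y * Z p r y)) = 0 by exact: D.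
rewrite big_split /= /GRing.scale /=.
under eq_bigr => t _ do rewrite mulrN mulr_sumr.
under [X in _ + X]eq_bigr => t _ do rewrite mulrN mulr_sumr.
rewrite !sumrN [X in _ - X]exchange_big /= -opprD -big_split /=.
apply/eqP; rewrite oppr_eq0; apply/eqP; apply: big1 => t _.
rewrite -big_split /=; apply: big1 => s _.
by rewrite /adjoint_coef; ring.
Qed.

(** Two solutions with the same value at the origin agree.  The adjoint matrix
    is a left inverse of the fundamental matrix [Y], hence invertible, so the
    constant product determines the solution. *)
Lemma solution_unique (rho : K) (Z Y : 'I_n -> 'I_n -> 'rV[K]_k -> K)
    (y z : 'I_n -> 'rV[K]_k -> K) :
  (forall t r u x, ball (0 : 'rV[K]_k) rho x ->
     pd u (Z t r) x (- \sum_(p < n) adjoint_coef t p u x * Z p r x)) ->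
  (forall t r, Z t r 0 = (t == r)%:R) ->
  (forall t r u x, ball (0 : 'rV[K]_k) rho x ->
     pd u (Y t r) x (- \sum_(p < n) f t p u x * Y p r x)) ->
  (forall t r, Y t r 0 = (t == r)%:R) ->
  (forall t u x, ball (0 : 'rV[K]_k) rho x ->
     pd u (y t) x (- \sum_(s < n) f t s u x * y s x)) ->
  (forall t u x, ball (0 : 'rV[K]_k) rho x ->
     pd u (z t) x (- \sum_(s < n) f t s u x * z s x)) ->
  (forall t, z t 0 = y t 0) ->
  forall r x, ball (0 : 'rV[K]_k) rho x -> z r x = y r x.
Proof.
move=> pZ Z0 pY Y0 py pz yz r x bx.
pose Zx := \matrix_(r, t) Z t r x; pose Yx := \matrix_(t, s) Y t s x.
have ZY : Zx *m Yx = 1%:M.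
  apply/matrixP => i j; rewrite !mxE.
  rewrite -(Y0 i j) -(adjoint_integrating_factor pZ Z0 (fun t u x => pY t j u x) i bx).
  by apply: eq_bigr => t _; rewrite !mxE.
pose c := \col_t (z t x - y t x).
have Zc : Zx *m c = 0.
  apply/colP => i; rewrite !mxE.
  under eq_bigr => t _ do rewrite !mxE mulrBr.
  rewrite sumrB (adjoint_integrating_factor pZ Z0 pz i bx).
  by rewrite (adjoint_integrating_factor pZ Z0 py i bx) yz subrr.
have c0 : c = 0 by rewrite -[c]mul1mx -(mulmx1C ZY) -mulmxA Zc mulmx0.
by have := congr1 (fun M : 'cV_n => M r 0) c0; rewrite !mxE => /subr0_eq.
Qed.

End Uniqueness.

Theorem theorem2p1 (R : realType) (K : numFieldType)
  (hK : K = R :> numFieldType \/ K = R[i]%C :> numFieldType)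
  (n k : nat) (hn : (1 <= n)%N) (hk : (1 <= k)%N)
  (f : 'I_n -> 'I_n -> 'I_k -> 'rV[K]_k -> K)
  (U : set 'rV[K]_k) (hU : open_nbhs (0 : 'rV[K]_k) U)
  (hf : forall (r s : 'I_n) (u : 'I_k) (x : 'rV[K]_k),
     U x -> analytic_at (f r s u) x)
  (hint : forall (u v : 'I_k) (t s : 'I_n) (x : 'rV[K]_k),
     U x -> integrability f t s u v x = 0) :
  exists P : multi_index k -> 'I_n -> 'I_n -> 'rV[K]_k -> K,
    (forall (t s : 'I_n) (x : 'rV[K]_k), U x ->
       P (midx0 k) t s x = (t == s)%:R) /\
    (forall (w : multi_index k) (u : 'I_k) (t s : 'I_n) (x : 'rV[K]_k), U x ->
       has_partial u (P w t s) x /\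
       P (midx_incr w u) t s x
       = partial u (P w t s) x + \sum_(p < n) f t p u x * P w p s x) /\
    (forall C : 'I_n -> K,
       exists (rho : K) (y : 'I_n -> 'rV[K]_k -> K),
         [/\ 0 < rho, ball (0 : 'rV[K]_k) rho `<=` U,
             (* y is given by the series *)
             forall (r : 'I_n) (x : 'rV[K]_k), ball (0 : 'rV[K]_k) rho x ->
               exists q : 'I_n -> K,
                 (forall s : 'I_n,
                    iterated_sum_to k
                      (fun w => solution_term P C r s x (midx_of_seq k w))
                      (q s)) /\
                 y r x = \sum_(s < n) q s,
             (* y solves the initial value problem *)
             solves_on f (ball (0 : 'rV[K]_k) rho) y /\
             (forall s : 'I_n, y s 0 = C s)
           & (* uniqueness *)
             forall (rho' : K) (z : 'I_n -> 'rV[K]_k -> K),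
               0 < rho' -> rho' <= rho ->
               solves_on f (ball (0 : 'rV[K]_k) rho') z ->
               (forall s : 'I_n, z s 0 = C s) ->
               forall (r : 'I_n) (x : 'rV[K]_k),
                 ball (0 : 'rV[K]_k) rho' x -> z r x = y r x]).
Proof.
have cK : calculus_field K.
  by case: hK => ->; [exact: real_calculus_field|exact: complex_calculus_field].
have [oU U0] := hU.
exists (covs f); split; first by move=> t s x _; rewrite covs0.
split.
  move=> w u t s x Ux; split.
    exact: (tame_has_partial cK oU hf (@tame_covs K n k f w) Ux).
  exact: (covs_incr cK oU hf hint) Ux.
move=> C.
have [rho1 rho10 [sub1 [[D1 bD1] pY Y0]]] := fundamental_solution cK oU U0 hf hint.
have [rho2 rho20 [_ [_ pZ Z0]]] := fundamental_solution cK oU U0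
  (adjoint_analytic hf) (adjoint_integrability cK oU hf hint).
have [rho rho0 [le1 le2]] := exists_pos_le2 rho10 rho20.
pose Y := fundamental f; pose Z := fundamental (adjoint_coef f).
pose y r x := \sum_(s < n) Y r s x * C s.
have py t u x : ball (0 : 'rV[K]_k) rho x ->
    is_derive x (basis_vec K u) (y t) (- \sum_(s < n) f t s u x * y s x).
  move=> /(le_ball le1) bx.
  have D := is_derive_sum (fun s => is_deriveZ (C s) (pY t s u x bx)).
  rewrite (_ : y t = \sum_(s < n) (C s \*: Y t s)); last first.
    by apply: funext => x'; rewrite fct_sumE; apply: eq_bigr => s _; exact: mulrC.
  suff <- : \sum_(s < n) (C s *: - (\sum_(p < n) f t p u x * Y p s x)) =
      - \sum_(s < n) f t s u x * y s x by exact: D.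
  rewrite /y -sumrN.
  under eq_bigr => s _ do rewrite /GRing.scale /= mulrN mulr_sumr -sumrN.
  rewrite exchange_big /=; apply: eq_bigr => p _.
  rewrite mulr_sumr -sumrN; apply: eq_bigr => s _.
  by rewrite mulrCA mulrA [X in _ = - X]mulrCA mulrA [X in _ = - X]mulrC; ring.
have y0 s : y s 0 = C s.
  rewrite /y (bigD1 s) //= big1 ?addr0; first by rewrite [Y _ _ _]Y0 eqxx mul1r.
  by move=> t ts; rewrite [Y _ _ _]Y0 eq_sym (negPf ts) mul0r.
have q0 : 0 <= 2^-1 :> K by rewrite invr_ge0.
have q1 : 2^-1 < 1 :> K by rewrite invf_lt1 // ltr1n.
exists rho, y; split => //.
- by move=> x /(le_ball le1)/sub1.
- move=> r x /(le_ball le1) bx.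
  exists (fun s => msum (solution_term (covs f) C r s x)); split=> [s|].
    have : mbounded 2^-1 (`|C s| * D1) (solution_term (covs f) C r s x).
      move=> w; rewrite /solution_term mulrC.
      exact: (mboundedZ (C s) (bD1 r s x bx) w).
    by case/(msum_spec cK q0 q1).
  apply: eq_bigr => s _; rewrite mulrC -(msumZ cK (C s) q0 q1 (bD1 r s x bx)).
  by apply: eq_msum => w; rewrite /solution_term [RHS]mulrC.
- split=> // r u x bx; have [hd hl] := py r u x bx; split=> //.
  by rewrite /partial hl addNr.
- move=> rho' z rho'0 le' sz z0 r x bx.
  have pz t u x' : ball (0 : 'rV[K]_k) rho' x' ->
      is_derive x' (basis_vec K u) (z t) (- \sum_(s < n) f t s u x' * z s x').
    move=> /(sz t u)[hd /eqP]; rewrite addr_eq0 => /eqP <-.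
    exact: pdP.
  have w1 x' : ball (0 : 'rV[K]_k) rho' x' -> ball (0 : 'rV[K]_k) rho1 x'.
    by apply: le_ball; exact: le_trans le1.
  have w2 x' : ball (0 : 'rV[K]_k) rho' x' -> ball (0 : 'rV[K]_k) rho2 x'.
    by apply: le_ball; exact: le_trans le2.
  apply: (solution_unique cK (rho := rho') (Z := Z) (Y := Y)) bx => //.
  + by move=> t r' u x' /w2; exact: pZ.
  + by move=> t r' u x' /w1; exact: pY.
  + by move=> t u x' /(le_ball le'); exact: py.
  + exact: pz.
  + by move=> t; rewrite z0 y0.
Qed.
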